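(* Let $n\ge 2$. An element $w\in\tilde C_n$ is CFC if and only if one (equivalently, any) of its reduced expressions $\mathbf{w}$ satisfies one of the following three conditions: (a) each generator occurs at most once in $\mathbf{w}$; (b) $\mathbf{w}$ is an alternating word and $|\mathbf{w}_t|=|\mathbf{w}_{s_1}|=\cdots=|\mathbf{w}_{s_{n-1}}|=|\mathbf{w}_u|\ge 2$; (c) $\mathbf{w}$ is a subword of the infinite periodic word $(ts_1s_2\cdots s_{n-1}us_{n-1}\cdots s_2s_1)^{\infty}$, where $|\mathbf{w}_{s_1}|=\cdots=|\mathbf{w}_{s_{n-1}}|\ge 2$ and $|\mathbf{w}_t|=|\mathbf{w}_u|=|\mathbf{w}_{s_1}|/2$.
   Context: $\tilde C_n$ is the affine Coxeter group with generators $t,s_1,\dots,s_{n-1},u$ whose Coxeter diagram is the path $t-s_1-\cdots-s_{n-1}-u$, with $m_{ts_1}=m_{s_{n-1}u}=4$ and $m=3$ on all other edges (non-adjacent generators commute). An element of a Coxeter group is fully commutative (FC) if any two of its reduced expressions are related by a sequence of transpositions of adjacent commuting generators. A cyclic shift of a word $s_{i_1}\cdots s_{i_k}$ is any word $s_{i_j}\cdots s_{i_k}s_{i_1}\cdots s_{i_{j-1}}$. An element is cyclically fully commutative (CFC) if every cyclic shift of every one of its reduced expressions is a reduced expression of an FC element. $|\mathbf{w}_s|$ is the number of occurrences of the generator $s$ in $\mathbf{w}$. Write $s_0=t$, $s_n=u$. A reduced word is alternating if for each $i=0,\dots,n-1$ the occurrences of $s_i$ alternate with those of $s_{i+1}$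 (i.e. in the sequence obtained by keeping only the letters $s_i,s_{i+1}$, no two consecutive letters are equal). ''Subword'' of an infinite word means a finite factor consisting of consecutive letters. Thus words in (c) are of the form $s_is_{i+1}\cdots s_{i-2}s_{i-1}$ or $s_is_{i-1}\cdots s_{i+2}s_{i+1}$, read along the periodic word. *)

(* Defs.v *)
From HB Require Import structures.
From mathcomp Require Import all_boot.
From mathcomp Require Import boolp.

Set Implicit Arguments.
Unset Strict Implicit.
Unset Printing Implicit Defensive.

(* The value 0 encodes an infinite order, i.e. no relation. *)
Record coxeter_matrix (I : finType) := CoxeterMatrix {
  cox_m :> I -> I -> nat;
  cox_mC : forall s t, cox_m s t = cox_m t s;
  cox_m1 : forall s t, (cox_m s t == 1%N) = (s == t)
}.

Section CoxeterGroup.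
Local Open Scope quotient_scope.
Local Open Scope group_scope.
Variables (I : finType) (m : coxeter_matrix I).

(* The congruence on words generated by (s t)^(m s t) = 1.  As m s s = 1, it
   contains s s = 1, so the quotient monoid is the group with this
   presentation. *)
Inductive cox_equiv : seq I -> seq I -> Prop :=
| cox_refl w : cox_equiv w w
| cox_sym w1 w2 : cox_equiv w1 w2 -> cox_equiv w2 w1
| cox_trans w1 w2 w3 : cox_equiv w1 w2 -> cox_equiv w2 w3 -> cox_equiv w1 w3
| cox_cat u1 u2 v1 v2 : cox_equiv u1 u2 -> cox_equiv v1 v2 ->
    cox_equiv (u1 ++ v1) (u2 ++ v2)
| cox_rel s t : cox_equiv (flatten (nseq (m s t) [:: s; t])) [::].

Definition cox_equivb (w1 w2 : seq I) : bool := `[< cox_equiv w1 w2 >].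

Lemma cox_equivb_equiv : equiv_class_of cox_equivb.
Proof.
split=> [w | w1 w2 | w2 w1 w3].
- exact/asboolP/cox_refl.
- by apply/asboolP/asboolP; apply: cox_sym.
- by move=> /asboolP h1 /asboolP h2; apply/asboolP/(cox_trans h1 h2).
Qed.

Canonical cox_equivb_rel := EquivRelPack cox_equivb_equiv.

Definition coxeter_group := {eq_quot cox_equivb}.
HB.instance Definition _ := Choice.on coxeter_group.
HB.instance Definition _ := Quotient.on coxeter_group.

Implicit Types g h : coxeter_group.

Definition cox_pi (w : seq I) : coxeter_group := \pi_coxeter_group w.

Lemma cox_piP w1 w2 : cox_pi w1 = cox_pi w2 <-> cox_equiv w1 w2.
Proof.
by split=> [/eqmodP/asboolP | h] //; apply/eqmodP/asboolP.
Qed.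

Lemma cox_piK g : cox_pi (repr g) = g.
Proof. exact: reprK. Qed.

Lemma cox_repr w : cox_equiv (repr (cox_pi w)) w.
Proof. by apply/cox_piP; rewrite cox_piK. Qed.

Definition cox_one : coxeter_group := cox_pi [::].
Definition cox_mul g h : coxeter_group := cox_pi (repr g ++ repr h).
Definition cox_inv g : coxeter_group := cox_pi (rev (repr g)).

Lemma cox_mul_pi w1 w2 : cox_mul (cox_pi w1) (cox_pi w2) = cox_pi (w1 ++ w2).
Proof. by apply/cox_piP; apply: cox_cat; apply: cox_repr. Qed.

Lemma cox_equiv_ss s : cox_equiv [:: s; s] [::].
Proof.
by have := cox_rel s s; have /eqP-> : m s s == 1%N by rewrite cox_m1.
Qed.

Lemma cox_equiv_revl w : cox_equiv (rev w ++ w) [::].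
Proof.
elim: w => [|s w IH]; first exact: cox_refl.
rewrite rev_cons -cats1 -catA /= -(cat1s s w) -[s :: _]/([:: s; s] ++ w).
apply: cox_trans IH; apply: cox_cat (cox_refl _) _.
exact: cox_cat (cox_equiv_ss s) (cox_refl w).
Qed.

Lemma cox_mulA : associative cox_mul.
Proof.
move=> g h g'; rewrite -(cox_piK g) -(cox_piK h) -(cox_piK g').
by rewrite !cox_mul_pi catA.
Qed.

Lemma cox_mul1g : left_id cox_one cox_mul.
Proof. by move=> g; rewrite -(cox_piK g) cox_mul_pi. Qed.

Lemma cox_mulg1 : right_id cox_one cox_mul.
Proof. by move=> g; rewrite -(cox_piK g) cox_mul_pi cats0. Qed.

Lemma cox_mulVg : left_inverse cox_one cox_inv cox_mul.
Proof.
move=> g; rewrite -{2}(cox_piK g) cox_mul_pi.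
exact/cox_piP/cox_equiv_revl.
Qed.

Lemma cox_mulgV : right_inverse cox_one cox_inv cox_mul.
Proof.
move=> g; rewrite -{1}(cox_piK g) cox_mul_pi; apply/cox_piP.
by rewrite -{1}(revK (repr g)); apply: cox_equiv_revl.
Qed.

HB.instance Definition _ :=
  isGroup.Build coxeter_group cox_mulA cox_mul1g cox_mulg1 cox_mulVg cox_mulgV.

Definition cox_gen (s : I) : coxeter_group := cox_pi [:: s].

Definition word_val (w : seq I) : coxeter_group := \prod_(s <- w) cox_gen s.

Lemma word_valE w : word_val w = cox_pi w.
Proof.
rewrite /word_val; elim: w => [|s w IH]; first by rewrite big_nil.
by rewrite big_cons IH -[LHS]/(cox_mul _ _) cox_mul_pi.
Qed.

Definition reduced (w : seq I) : Prop :=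
  forall w', word_val w' = word_val w -> (size w <= size w')%N.

Definition reduced_expr (w : seq I) (g : coxeter_group) : Prop :=
  word_val w = g /\ reduced w.

Inductive commutation_equiv : seq I -> seq I -> Prop :=
| comm_refl w : commutation_equiv w w
| comm_step u v w s t : commute (cox_gen s) (cox_gen t) ->
    commutation_equiv (u ++ [:: t, s & v]) w ->
    commutation_equiv (u ++ [:: s, t & v]) w.

Definition fully_commutative (g : coxeter_group) : Prop :=
  forall w w', reduced_expr w g -> reduced_expr w' g -> commutation_equiv w w'.

Definition cyclically_fully_commutative (g : coxeter_group) : Prop :=
  forall w, reduced_expr w g ->
  forall k, reduced (rot k w) /\ fully_commutative (word_val (rot k w)).

End CoxeterGroup.

(* The generators t = s_0, s_1, ..., s_(n-1), u = s_n are indexed by 'I_n.+1.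
   This is the Coxeter matrix of the affine type C only for n >= 2. *)
Definition affineC_m (n : nat) (i j : 'I_n.+1) : nat :=
  if i == j then 1
  else if (i.+1 == j :> nat) || (j.+1 == i :> nat) then
    if (minn i j == 0) || (maxn i j == n) then 4 else 3
  else 2.

Lemma affineC_mC n (i j : 'I_n.+1) : affineC_m i j = affineC_m j i.
Proof. by rewrite /affineC_m eq_sym orbC minnC maxnC. Qed.

Lemma affineC_m1 n (i j : 'I_n.+1) : (affineC_m i j == 1%N) = (i == j).
Proof. by rewrite /affineC_m; do 3?case: ifP. Qed.

Definition affineC_matrix (n : nat) : coxeter_matrix 'I_n.+1 :=
  CoxeterMatrix (@affineC_mC n) (@affineC_m1 n).

Definition affineC (n : nat) := coxeter_group (affineC_matrix n).

Definition alternating (n : nat) (w : seq 'I_n.+1) : Prop :=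
  forall i j : 'I_n.+1, i.+1 = j :> nat ->
  sorted (fun x y : 'I_n.+1 => x != y) [seq x <- w | x \in [:: i; j]].

(* One period t s_1 ... s_(n-1) u s_(n-1) ... s_1. *)
Definition zigzag_period (n : nat) : seq 'I_n.+1 :=
  [seq inord i | i <- iota 0 n.+1 ++ rev (iota 1 n.-1)].

Definition zigzag (n : nat) (k : nat) : 'I_n.+1 :=
  nth ord0 (zigzag_period n) (k %% size (zigzag_period n)).

Definition zigzag_subword (n : nat) (w : seq 'I_n.+1) : Prop :=
  exists k, w = [seq zigzag n i | i <- iota k (size w)].

Definition cfc_condition (n : nat) (w : seq 'I_n.+1) : Prop :=
  [\/ forall s : 'I_n.+1, count_mem s w <= 1,
      alternating w /\
      (exists2 c, 2 <= c & forall s : 'I_n.+1, count_mem s w = c)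
    | zigzag_subword w /\
      (exists2 c, 2 <= c &
        [/\ forall s : 'I_n.+1, 0 < s < n -> count_mem s w = c,
            2 * count_mem ord0 w = c
          & 2 * count_mem ord_max w = c])]%N.

(* Main.v *)
Require Import Defs.
From mathcomp Require Import all_boot.
From mathcomp Require Import boolp.
From mathcomp Require Import zify.

(** Sufficiency.  Call a word braid avoiding if no word obtained from it by
    commutations contains a square s s, or a factor s t s or s t s t of length
    m(s,t) > 2.  A braid avoiding word is reduced, and every reduced word of
    the same element is obtained from it by commutations (braid_avoiding_fc).
    This rests on the exchange condition, which follows from the fact that the
    parity with which a word crosses a given reflection depends only on the
    group element (crosses_equiv), and on the fact that the generators have the
    prescribed pairwise orders, which is read off an action on signed points.
    The words of types (a), (b) and (c) are braid avoiding, since each of the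
    three types is stable under commutations and excludes squares and braids;
    each is also stable under rotation.  So every rotation of every reduced
    word of the element is again of its type, hence reduced and fully
    commutative.

    Necessity.  If no letter is repeated there is nothing to prove.  Unroll a
    reduced word w of a CFC element into a periodic walk
    W : nat -> nat on 0, ..., n, with period N, the size of w.  Each window of
    length N is a rotation of w, hence reduced and fully commutative, so no
    window can be rewritten into one that contains a square or a braid.  In terms
    of gaps, i.e. intervals between consecutive occurrences of a letter i that
    is repeated in w: a gap contains a neighbour of i; if i is interior, a gap contains two
    occurrences of neighbours unless its only one is an endpoint; and the
    factor s t s t of an edge labelled 4 does not occur (word_walk).

    A gap of an interior letter i is a turn if it misses a neighbour of i: it
    is upper if it misses i-1 and lower if it misses i+1.  The heart of the
    proof is that an upper gap is followed by a lower one (upper_next) and,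
    by the symmetry of the diagram, conversely.  As an upper gap at i
    contains an upper gap at i+1, and a lower one a lower gap at i-1, one
    turn forces every gap of every interior letter to be a turn, with
    alternating directions.  Then an upper gap of i contains no letter below
    i, and a lower gap none above, which leaves no freedom: the walk goes
    from neighbour to neighbour and reverses only at 0 and n, and w is of
    type (c).  If a letter is repeated but there is no turn, every letter is
    repeated and between two occurrences of a letter there is one of each of
    its neighbours, so w is of type (b). *)

Set Implicit Arguments.
Unset Strict Implicit.
Unset Printing Implicit Defensive.

(** * The exchange condition *)

Section Exchange.
Local Open Scope group_scope.
Variables (I : finType) (m : coxeter_matrix I).

Local Notation val := (word_val m).
Local Notation g := (cox_gen m).

Lemma word_val_nil : val [::] = 1.
Proof. by rewrite /word_val big_nil. Qed.

Lemma word_val_cons s w : val (s :: w) = g s * val w.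
Proof. by rewrite /word_val big_cons. Qed.

Lemma word_val_cat u v : val (u ++ v) = val u * val v.
Proof. by rewrite !word_valE -cox_mul_pi. Qed.

Lemma word_val_seq1 s : val [:: s] = g s.
Proof. by rewrite word_valE. Qed.

Lemma word_val_rcons u s : val (rcons u s) = val u * g s.
Proof. by rewrite -cats1 word_val_cat word_val_seq1. Qed.

Lemma cox_equivP w1 w2 : val w1 = val w2 <-> cox_equiv m w1 w2.
Proof. by rewrite !word_valE cox_piP. Qed.

Lemma cox_gen2 s : g s * g s = 1.
Proof.
by rewrite -!word_val_seq1 -word_val_cat -word_val_nil; apply/cox_equivP/cox_equiv_ss.
Qed.

Lemma cox_genV s : (g s)^-1 = g s.
Proof. by apply: (mulgI (g s)); rewrite mulgV cox_gen2. Qed.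

Lemma cox_genK s x : g s * (g s * x) = x.
Proof. by rewrite mulgA cox_gen2 mul1g. Qed.

Lemma cox_gen_expg s t : (g s * g t) ^+ m s t = 1.
Proof.
have <- : val (flatten (nseq (m s t) [:: s; t])) = (g s * g t) ^+ m s t.
  elim: (m s t) => [|k IH]; first by rewrite word_val_nil.
  by rewrite expgS -IH !word_val_cons mulgA.
by rewrite -word_val_nil; apply/cox_equivP/cox_rel.
Qed.

Lemma cox_equiv_odd_size w1 w2 : cox_equiv m w1 w2 -> odd (size w1) = odd (size w2).
Proof.
elim=> //= [w3 w4 w5 _ -> _ -> //|u1 u2 v1 v2 _ h1 _ h2|s t].
  by rewrite !size_cat !oddD h1 h2.
by elim: (m s t) => //= k ->.
Qed.

(** The reflections crossed by the gallery of the word, in order: the entry of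
    the letter s_i is s_1 ... s_(i-1) s_i s_(i-1) ... s_1. *)
Fixpoint reflections (w : seq I) : seq (coxeter_group m) :=
  if w is s :: w' then g s :: [seq g s * r * g s | r <- reflections w']
  else [::].

Lemma reflections_cat u v :
  reflections (u ++ v) =
  reflections u ++ [seq val u * r * (val u)^-1 | r <- reflections v].
Proof.
elim: u => [|s u IH] /=.
  by rewrite word_val_nil -[LHS]map_id; apply: eq_map => r; rewrite mul1g invg1 mulg1.
rewrite IH map_cat -map_comp; congr (_ :: _ ++ _); apply: eq_map => r /=.
by rewrite word_val_cons invgM cox_genV !mulgA.
Qed.

Definition crosses w r := odd (count_mem r (reflections w)).

Lemma crosses_cat u v r :
  crosses (u ++ v) r = crosses u r (+) crosses v ((val u)^-1 * r * val u).
Proof.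
rewrite /crosses reflections_cat count_cat oddD count_map; congr (_ (+) odd _).
apply: eq_count => x /=; apply/eqP/eqP => [<-|->]; last first.
  by rewrite !mulgA mulgV mul1g mulgK.
by rewrite !mulgA mulVg mul1g mulgVK.
Qed.

(** For a power of s t the reflections are the successive (s t)^i s; since s t
    has order dividing m(s,t), the word (s t)^m(s,t) crosses each of them an even
    number of times. *)
Lemma reflections_dihedral s t k :
  reflections (flatten (nseq k [:: s; t])) =
  [seq (g s * g t) ^+ i * g s | i <- iota 0 k.*2].
Proof.
elim: k => //= k IH.
rewrite expg0 mul1g expg1 IH; congr (_ :: _ :: _).
rewrite -[2]/(2 + 0)%N iotaDl -!map_comp; apply: eq_map => i /=.
by rewrite -[(2 + i)%N]/i.+2 expgS expgSr !mulgA.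
Qed.

Lemma crosses_rel s t r : crosses (flatten (nseq (m s t) [:: s; t])) r = false.
Proof.
rewrite /crosses reflections_dihedral -addnn iotaD map_cat count_cat add0n.
rewrite -{2}[m s t]addn0 iotaDl -map_comp.
set a := count _ _; set b := count _ _; suff -> : a = b by rewrite addnn odd_double.
by congr count; apply: eq_map => i /=; rewrite expgnDr cox_gen_expg mul1g.
Qed.

(** Crossing parities are multiplicative in the sense of crosses_cat, and the
    defining relators cross every reflection an even number of times. *)
Lemma crosses_equiv w1 w2 : cox_equiv m w1 w2 -> crosses w1 =1 crosses w2.
Proof.
elim=> [//|w3 w4 _ IH r|w3 w4 w5 _ h1 _ h2 r|u1 u2 v1 v2 e1 h1 _ h2 r|s t r].
- by rewrite IH.
- by rewrite h1.
- by rewrite !crosses_cat h1 h2; move/cox_equivP: e1 => ->.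
- by rewrite crosses_rel.
Qed.

(** The reflection s_1 ... s_i ... s_1 cancels against the prefix s_1 ... s_i of
    the word, leaving s_1 ... s_(i-1), which removes the i-th letter. *)
Lemma mem_reflections w r : r \in reflections w ->
  exists i, (i < size w)%N /\ val (take i w ++ drop i.+1 w) = r * val w.
Proof.
elim: w r => //= s w IH r; rewrite in_cons => /orP[/eqP->|/mapP[r' /IH[i [lti e]] ->]].
  by exists 0; rewrite take0 drop0 word_val_cons mulgA cox_gen2 mul1g.
exists i.+1; split=> //=; rewrite !word_val_cons e.
by rewrite !mulgA -(mulgA _ (g s) (g s)) cox_gen2 mulg1.
Qed.

Lemma reduced_exists (x : coxeter_group m) : exists w, reduced_expr w x.
Proof.
have ex : exists k, `[< exists w, val w = x /\ size w = k >].
  by exists (size (repr x)); apply/asboolP; exists (repr x); rewrite word_valE cox_piK.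
case: (ex_minnP ex) => k /asboolP[w [e <-]] kmin; exists w; split=> // w' e'.
by apply: kmin; apply/asboolP; exists w'; rewrite e'.
Qed.

Lemma reduced_eq w w' : reduced m w -> val w' = val w -> size w' = size w ->
  reduced m w'.
Proof. by move=> rw e es v ev; rewrite es; apply: rw; rewrite ev. Qed.

Lemma reduced_size w w' : reduced m w -> reduced m w' -> val w = val w' ->
  size w = size w'.
Proof. by move=> h h' e; apply/eqP; rewrite eqn_leq h ?h'. Qed.

Lemma reduced_catl u v : reduced m (u ++ v) -> reduced m u.
Proof.
move=> h u' e; have := h (u' ++ v); rewrite !word_val_cat e !size_cat leq_add2r.
exact.
Qed.

(** Let v be a reduced word of the shorter element w s.  The word v s
    crosses the reflection r = w s w^-1 with its last letter, and v does not
    cross r, for otherwise deleting a letter from v would give a word of w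
    shorter than w.  By invariance of parities w crosses r, so deleting a
    letter of w gives r w = w s. *)
Lemma exchange w s : reduced m w -> ~ reduced m (rcons w s) ->
  exists i, (i < size w)%N /\ val (take i w ++ drop i.+1 w) = val w * g s.
Proof.
move=> rw nr; have [v [ev rv]] := reduced_exists (val w * g s).
have ltv : (size v < size w)%N.
  have lev : (size v <= size w)%N.
    rewrite leqNgt; apply/negP => ltw; apply: nr => w' e'.
    by rewrite size_rcons; apply: leq_trans ltw (rv _ _); rewrite e' word_val_rcons ev.
  have : odd (size v) = odd (size (rcons w s)).
    by apply/cox_equiv_odd_size/cox_equivP; rewrite word_val_rcons.
  by rewrite size_rcons /=; case: ltngtP lev => // -> _; case: odd.
pose r := val w * g s * (val w)^-1.
(* v s is a word of w which crosses r exactly once, with its last letter. *)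
have e1 : val (rcons v s) = val w.
  by rewrite word_val_rcons ev -mulgA cox_gen2 mulg1.
have c1 : crosses w r.
  have /crosses_equiv -> : cox_equiv m w (rcons v s) by apply/cox_equivP.
  rewrite -cats1 crosses_cat /crosses.
  have -> : count_mem r (reflections v) = 0.
    apply/count_memPn/negP => /mem_reflections [i [lti e]].
    have := rw (take i v ++ drop i.+1 v).
    rewrite e ev /r !mulgA mulgVK -mulgA cox_gen2 mulg1 => /(_ erefl).
    rewrite size_cat size_take size_drop lti; lia.
  rewrite /= ev /r invgM cox_genV !mulgA mulgVK -!mulgA mulKg.
  by rewrite cox_gen2 mulg1 eqxx.
have /mem_reflections [i [lti e]] : r \in reflections w.
  by rewrite -has_pred1 has_count; move: c1; rewrite /crosses; case: count.
by exists i; rewrite e /r mulgVK.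
Qed.

(** When the word is split as z d, the deleted letter lies in z or in d.  In
    the first case the deletion exhibits a reduced word of the same element
    ending in d s, which is how longer and longer alternating suffixes are
    built in two_descents. *)
Lemma exchange_cat z d s : reduced m (z ++ d) -> ~ reduced m (rcons (z ++ d) s) ->
  (exists z', size z = (size z').+1 /\ val (z' ++ rcons d s) = val (z ++ d)) \/
  (exists j, (j < size d)%N /\ val (take j d ++ drop j.+1 d) = val d * g s).
Proof.
move=> r nr; have [i [lti e]] := exchange r nr.
have [ltz|lez] := ltnP i (size z).
  left; exists (take i z ++ drop i.+1 z); split.
    by rewrite size_cat size_take size_drop ltz; lia.
  move: e; rewrite take_cat ltz drop_cat.
  have [_|eqz] := ltnP i.+1 (size z); last first.
    have -> : i.+1 = size z by lia.
    rewrite subnn drop0 drop_size cats0 => e.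
    by rewrite -rcons_cat word_val_rcons e -mulgA cox_gen2 mulg1.
  by rewrite catA => e; rewrite -rcons_cat word_val_rcons e -mulgA cox_gen2 mulg1.
right; exists (i - size z); split; first by move: lti; rewrite size_cat; lia.
move: e; rewrite take_cat drop_cat !ltnNge lez leqW //= subSn //.
by rewrite -catA !word_val_cat -!mulgA => /mulgI ->.
Qed.

End Exchange.

(** * Braid avoiding words *)

Section Commutation.
Local Open Scope group_scope.
Variables (I : finType) (m : coxeter_matrix I).

Local Notation val := (word_val m).
Local Notation g := (cox_gen m).
Local Notation ceq := (commutation_equiv m).

Lemma commutation_trans u v w : ceq u v -> ceq v w -> ceq u w.
Proof.
move=> h; elim: h w => // {u v} u v w s t c _ IH x hx.
by apply: comm_step c _; apply: IH.
Qed.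

Lemma commutation_swap u v s t : commute (g s) (g t) ->
  ceq (u ++ [:: s, t & v]) (u ++ [:: t, s & v]).
Proof. by move=> c; apply: comm_step c _; apply: comm_refl. Qed.

Lemma commutation_sym u v : ceq u v -> ceq v u.
Proof.
elim=> [w|{}u {}v w s t c _ IH]; first exact: comm_refl.
by apply: commutation_trans IH _; apply/commutation_swap/commute_sym.
Qed.

Lemma commutation_catr u v x : ceq u v -> ceq (u ++ x) (v ++ x).
Proof.
elim=> [w|{}u {}v w s t c _ IH]; first exact: comm_refl.
by rewrite -catA; apply: comm_step c _; move: IH; rewrite -catA.
Qed.

Lemma commutation_perm u v : ceq u v -> perm_eq u v.
Proof.
elim=> // {}u {}v w s t _ _; apply: perm_trans.
by rewrite perm_cat2l -[s :: _]/([:: s] ++ [:: t] ++ v) perm_catCA.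
Qed.

Lemma commutation_val u v : ceq u v -> val u = val v.
Proof.
elim=> // {}u {}v w s t c _ <-.
by rewrite !word_val_cat !word_val_cons !mulgA -(mulgA _ (g s)) c !mulgA.
Qed.

(** Commutations never exchange two letters that do not commute, so the order
    in which such a pair of letters occurs is an invariant of the
    commutation class. *)
Lemma commutation_project a b u v : (a != b -> ~ commute (g a) (g b)) ->
  ceq u v -> [seq x <- u | x \in [:: a; b]] = [seq x <- v | x \in [:: a; b]].
Proof.
move=> nab; elim=> // {}u {}v w s t c _ <-; rewrite !filter_cat /=.
have [hs|//] := boolP (s \in _); have [ht|//] := boolP (t \in _).
move: hs ht; rewrite !inE => /orP[] /eqP es /orP[] /eqP et; subst s t => //.
- by have [->//|/nab] := eqVneq a b.
- by have [->//|/nab []] := eqVneq a b; apply: commute_sym.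
Qed.

(** The alternating word in s and t of length m(s,t), for m(s,t) <= 4, that
    ends in s. *)
Definition alternating_braid s t := drop (4 - m s t) [:: t; s; t; s].

Inductive has_braid : seq I -> Prop :=
| HasSquare A C s : has_braid (A ++ [:: s; s] ++ C)
| HasBraid A C s t : s != t -> (2 < m s t)%N ->
    has_braid (A ++ alternating_braid s t ++ C).

Definition braid_avoiding w := forall w', ceq w w' -> ~ has_braid w'.

Lemma braid_avoiding_comm w w' : braid_avoiding w -> ceq w w' -> braid_avoiding w'.
Proof. by move=> h e v ev; apply: h; apply: commutation_trans ev. Qed.

Lemma braid_avoiding_catl u v : braid_avoiding (u ++ v) -> braid_avoiding u.
Proof.
move=> h w e b; apply: (h (w ++ v)); first exact: commutation_catr.
by case: b {e} => [A C s|A C s t st lt]; rewrite -!catA; constructor.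
Qed.

Hypothesis m_le4 : forall s t, s != t -> (1 < m s t <= 4)%N.
Hypothesis gen_inj : injective g.
Hypothesis gen_noncomm : forall s t, (2 < m s t)%N -> ~ commute (g s) (g t).

Lemma gen_comm s t : m s t = 2%N -> commute (g s) (g t).
Proof.
move=> e; have := cox_gen_expg m s t; rewrite e expg2 => h.
have := congr1 (fun x => g t * (g s * x)) h.
by rewrite mulg1 -!mulgA !cox_genK.
Qed.

(** Each side is obtained from the other by cancelling against a copy of
    the relator (s t)^m(s,t). *)
Lemma alternating_braid_val s t : s != t ->
  val (alternating_braid s t) = val (alternating_braid t s).
Proof.
move=> st; have := cox_gen_expg m s t; rewrite /alternating_braid (cox_mC m t s).
have := m_le4 st; case: (m s t) => [|[|[|[|[|k]]]]] //= _ h.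
- rewrite !word_val_cons word_val_nil !mulg1 -[LHS]mulg1 -h.
  by rewrite !expgS expg0 !mulg1 -!mulgA !cox_genK.
- rewrite !word_val_cons word_val_nil !mulg1 -[LHS]mulg1 -h.
  by rewrite !expgS expg0 !mulg1 -!mulgA !cox_genK.
- rewrite !word_val_cons word_val_nil !mulg1 -[LHS]mulg1 -h.
  by rewrite !expgS expg0 !mulg1 -!mulgA !cox_genK.
Qed.

Lemma not_reduced_rcons w x t : reduced m w -> val w = val (rcons x t) ->
  size x < size w -> ~ reduced m (rcons w t).
Proof.
move=> rw e lx /(_ x); rewrite word_val_rcons e word_val_rcons -mulgA cox_gen2.
by rewrite mulg1 size_rcons => /(_ erefl); lia.
Qed.

(** Repeated exchange lengthens an alternating suffix in s and t.  At each step
    the alternative, a deletion inside the suffix, would be a relation between s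
    and t that forces s = t, or s t = t s although m(s,t) > 2. *)
Lemma two_descents w s t : s != t -> reduced m w ->
  ~ reduced m (rcons w s) -> ~ reduced m (rcons w t) ->
  exists z, val (z ++ alternating_braid s t) = val w /\ size w = (size z + m s t)%N.
Proof.
move=> st rw ds dt; have := m_le4 st; rewrite /alternating_braid => hm.
have step z d a : val (z ++ d) = val w -> size w = size (z ++ d) ->
    ~ reduced m (rcons w a) ->
    (exists z', val (z' ++ rcons d a) = val w /\ size w = size (z' ++ rcons d a)) \/
    (exists j, (j < size d)%N /\ val (take j d ++ drop j.+1 d) = val d * g a).
  move=> e es da; have rz := reduced_eq rw e (esym es).
  have nz : ~ reduced m (rcons (z ++ d) a).
    move=> h; apply: da; apply: reduced_eq h _ _; last by rewrite !size_rcons es.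
    by rewrite !word_val_rcons e.
  case: (exchange_cat rz nz) => [[z' [sz ez]]|]; [left|by right].
  by exists z'; rewrite ez e es !size_cat size_rcons sz addSnnS.
have neq : g s <> g t by move=> /gen_inj e; rewrite e eqxx in st.
have nc : (2 < m s t)%N -> g s * g t <> g t * g s by move=> h; apply: gen_noncomm.
case: (step w [::] s); rewrite ?cats0 //; last by case=> j [].
case=> z1 [e1 s1]; case: (step _ _ t e1 s1 dt); last first.
  case=> [[|j] []] // _; rewrite /= word_val_nil word_val_seq1 => h; case: neq.
  by rewrite -[LHS]mulg1 h cox_genK.
case=> z2 [e2 s2]; have [m2|m2] := leqP (m s t) 2.
  have {hm m2} m2 : m s t = 2%N by lia.
  exists z2; rewrite s2 size_cat m2 -e2 /= !word_val_cat; split=> //; congr (_ * _).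
  rewrite /= !word_val_cons !word_val_nil !mulg1; apply/esym; exact: gen_comm.
have {}nc := nc m2.
case: (step _ _ s e2 s2 ds); last first.
  case=> [[|[|j]] []] // _; rewrite /= !word_val_cons word_val_nil !mulg1 => h.
    by case: nc; rewrite /commute [in RHS]h -!mulgA cox_gen2 mulg1.
  case: neq; have := congr1 (fun x => x * g s * g t) h.
  by rewrite -!mulgA !cox_genK cox_gen2 mulg1.
case=> z3 [e3 s3]; have [m3|m3] := leqP (m s t) 3.
  have {hm m2 m3} m3 : m s t = 3 by lia.
  by exists z3; rewrite s3 size_cat m3 -e3 /=.
have {hm m2 m3} m4 : m s t = 4 by lia.
case: (step _ _ t e3 s3 dt); last first.
  have ord := cox_gen_expg m s t; rewrite m4 !expgS expg0 mulg1 -!mulgA in ord.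
  case=> [[|[|[|j]]] []] // _; rewrite /= !word_val_cons word_val_nil !mulg1 -!mulgA => h.
  - case: neq; move: ord; rewrite -h !cox_genK cox_gen2 mulg1 => h'.
    by rewrite -[LHS]mulg1 -h' cox_genK.
  - by case: nc; rewrite -[RHS]mulg1 -(cox_gen2 m s) h -!mulgA !cox_genK.
  - case: neq; have := congr1 (fun x => g t * (g s * x)) h.
    by rewrite !cox_genK cox_gen2 => h'; rewrite -[LHS]mulg1 h' cox_genK.
case=> z4 [e4 s4].
exists z4; rewrite s4 size_cat m4 -e4 /= !word_val_cat; split=> //; congr (_ * _).
by have := alternating_braid_val st; rewrite /alternating_braid (cox_mC m t s) m4.
Qed.

(** Induction on the length.  If w = x s were not reduced, x would have the
    descent s, so x would be equivalent by commutations to a word ending in s,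
    and w to one ending in s s.  If x s and y t are reduced words of the same
    element with s <> t, both letters are descents, so the element has a reduced
    word ending in the alternating word of s and t; by induction w is equivalent
    by commutations to that word, which is possible only if s and t commute,
    and then to z s t, where z s is equivalent to y. *)
Lemma braid_avoiding_fc w : braid_avoiding w ->
  reduced m w /\ (forall w', reduced m w' -> val w' = val w -> ceq w w').
Proof.
have [k] := ubnP (size w); elim: k w => // k IH w; rewrite ltnS => lek av.
have red : reduced m w.
  case/lastP: w av lek => [|x s] av; first by move=> _ w' _.
  rewrite size_rcons => lek; apply: contrapT => nr.
  rewrite -cats1 in av; have avx := braid_avoiding_catl av.
  have [rx ux] := IH x lek avx.
  have [i [lti e]] := exchange rx nr; set y := take i x ++ _ in e.
  have sy : (size y).+1 = size x by rewrite size_cat size_take size_drop lti; lia.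
  have ey : val (rcons y s) = val x by rewrite word_val_rcons e -mulgA cox_gen2 mulg1.
  have /ux : reduced m (rcons y s) by apply: reduced_eq rx ey _; rewrite size_rcons.
  move/(_ ey)/(commutation_catr [:: s])/av; apply.
  by rewrite -cats1 -catA; apply: (HasSquare y [::] s).
split=> // w' r' e'; have ss := reduced_size red r' (esym e').
case/lastP: w av lek red e' ss => [|x s] av lek red e' ss.
  by case: w' ss {r' e'} => // _; apply: comm_refl.
case/lastP: w' r' e' ss => [|y t] r' e' ss; first by rewrite size_rcons in ss.
have lex : (size x < k)%N by rewrite size_rcons in lek.
have avx : braid_avoiding x by move: av; rewrite -cats1; apply: braid_avoiding_catl.
have [rx ux] := IH x lex avx.
have sxy : size x = size y by move: ss; rewrite !size_rcons => -[].
have ry : reduced m y by move: r'; rewrite -cats1; apply: reduced_catl.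
have [est|st] := eqVneq s t.
  subst t; have exy : val y = val x.
    by move: e'; rewrite !word_val_rcons => /mulIg.
  by rewrite -!cats1; apply/commutation_catr/ux.
have ds : ~ reduced m (rcons (rcons x s) s).
  by apply: not_reduced_rcons erefl _; rewrite ?size_rcons.
have dt : ~ reduced m (rcons (rcons x s) t).
  by apply: not_reduced_rcons (esym e') _; rewrite ?size_rcons -?sxy.
have [z [ez sz]] := two_descents st red ds dt.
have [b eb sb] : exists2 b, alternating_braid s t = rcons b s & (size b).+1 = m s t.
  have := m_le4 st; rewrite /alternating_braid; case: (m s t) => [|[|[|[|[|?]]]]] // _.
  - by exists [:: t].
  - by exists [:: s; t].
  - by exists [:: t; s; t].
(* b is the alternating word without its last letter s, so x and z b are
   reduced words of the same element. *)
have ezb : val (z ++ b) = val x.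
  by move: ez; rewrite eb -rcons_cat !word_val_rcons => /mulIg.
have rzb : reduced m (z ++ b).
  by apply: reduced_eq rx ezb _; rewrite size_cat; move: sz; rewrite size_rcons; lia.
have c1 : ceq (rcons x s) (z ++ alternating_braid s t).
  by rewrite eb -cats1 -cats1 catA; apply/commutation_catr/ux.
(* If m(s,t) > 2 the class of w contains a braid. *)
have [m2|m2] := leqP (m s t) 2; last first.
  by case: (av _ c1); rewrite -[alternating_braid _ _]cats0; apply: HasBraid.
have {}m2 : m s t = 2%N by have := m_le4 st; lia.
have c2 : ceq (rcons x s) (z ++ [:: s; t]).
  apply: commutation_trans c1 _; rewrite /alternating_braid m2 /=.
  by apply/commutation_swap/commute_sym/gen_comm.
have avz : braid_avoiding (z ++ [:: s]).
  apply: (@braid_avoiding_catl _ [:: t]); rewrite -catA /=.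
  exact: braid_avoiding_comm av c2.
have sze : size (z ++ [:: s]) = size x.
  by move: sz; rewrite size_rcons size_cat /= m2; lia.
have [||_ uz] := IH (z ++ [:: s]); rewrite ?sze //.
have evy : val y = val (z ++ [:: s]).
  have := commutation_val c2; rewrite -e' -cat_rcons -cats1 -cats1 => /esym.
  by rewrite word_val_cat [in RHS]word_val_cat => /mulIg.
apply: commutation_trans c2 _; rewrite -cat_rcons -cats1 -cats1.
exact/commutation_catr/uz.
Qed.
End Commutation.

(** * The generators of the affine group of type C *)

Section SignedPermutations.
Variable n : nat.
Hypothesis n_ge2 : 2 <= n.

(** The action of the group on points 0, ..., n-1 with signs, through its
    quotient of type B_n: t changes the sign of point 0, s_i exchanges points
    i-1 and i, and u changes the sign of point n-1.  The quotient loses the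
    translations but is large enough to separate the generators and to
    show that adjacent ones do not commute. *)
Definition signed_act (i : nat) (x : bool * nat) : bool * nat :=
  if i == 0 then (x.1 (+) (x.2 == 0), x.2)
  else if i == n then (x.1 (+) (x.2 == n.-1), x.2)
  else (x.1, if x.2 == i then i.-1 else if x.2 == i.-1 then i else x.2).

(* Splits on the equality tests of the goal, innermost first, so that no
   hypothesis handed to the arithmetic solver contains a conditional. *)
Ltac split_eqs :=
  repeat (match goal with |- context [@eq_op _ ?a ?b] =>
    lazymatch a with context [if _ then _ else _] => fail | _ => idtac end;
    case: (a =P b) => /= ?; try (exfalso; lia) end).

Ltac act_cases :=
  rewrite /signed_act /=; split_eqs;
  rewrite ?addbT ?addbF ?negbK; first [reflexivity | congr pair; lia].

Lemma signed_actK i : involutive (signed_act i).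
Proof. move=> [b k]; act_cases. Qed.

Lemma signed_act_comm i j x : i.+1 < j ->
  signed_act i (signed_act j x) = signed_act j (signed_act i x).
Proof. by case: x => b k lij; act_cases. Qed.

Lemma signed_act_braid3 i x : 0 < i -> i.+1 < n ->
  signed_act i (signed_act i.+1 (signed_act i x)) =
  signed_act i.+1 (signed_act i (signed_act i.+1 x)).
Proof. by case: x => b k i0 iN; act_cases. Qed.

Lemma signed_act_braid4 i x : i = 0 \/ i.+1 = n ->
  signed_act i (signed_act i.+1 (signed_act i (signed_act i.+1 x))) =
  signed_act i.+1 (signed_act i (signed_act i.+1 (signed_act i x))).
Proof. by case: x => b k; case=> [-> | iN]; act_cases. Qed.

Definition signed_word (w : seq 'I_n.+1) (x : bool * nat) : bool * nat :=
  foldr (fun i : 'I_n.+1 => signed_act i) x w.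

Lemma affineC_mS (i j : 'I_n.+1) : i.+1 = j :> nat ->
  affineC_m i j = if ((i : nat) == 0) || (j == n :> nat) then 4 else 3.
Proof.
move=> e; rewrite /affineC_m -val_eqE /= e eqxx /=.
have lij : i < j by rewrite -e.
by rewrite (ltn_eqF lij) /minn /maxn lij.
Qed.

Lemma affineC_m2 (i j : 'I_n.+1) : i.+1 < j -> affineC_m i j = 2.
Proof.
move=> lij; rewrite /affineC_m -val_eqE /= (ltn_eqF lij) (ltn_eqF (ltnW lij)).
by have -> : (j.+1 == i) = false by lia.
Qed.

Lemma iter_signed_act i j k x :
  signed_word (flatten (nseq k [:: i; j])) x =
  iter k (fun y => signed_act i (signed_act j y)) x.
Proof. by elim: k x => //= k IH x; rewrite IH. Qed.

Lemma signed_word_rel (i j : 'I_n.+1) x :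
  signed_word (flatten (nseq (affineC_m i j) [:: i; j])) x = x.
Proof.
rewrite iter_signed_act; have [->|] := eqVneq i j.
  by rewrite /affineC_m eqxx /= !signed_actK.
wlog lij : i j x / i < j => [hw|_].
  move=> ne; have [lt|le] := ltnP i j; first exact: hw.
  have lt : j < i by rewrite ltn_neqAle le andbT eq_sym.
  rewrite affineC_mC -[x in LHS](signed_actK i) -[in RHS](signed_actK i x).
  rewrite -[in RHS](hw j i (signed_act i x)) // 1?eq_sym //.
  by elim: (affineC_m j i) => //= k ->.
case: (ltngtP i.+1 j) lij => // [lt|e] _.
  by rewrite affineC_m2 //= (signed_act_comm _ lt) !signed_actK.
rewrite (affineC_mS e); case: ifP => h /=; rewrite -e.
  have h' : i = 0 :> nat \/ i.+1 = n by lia.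
  by rewrite signed_act_braid4 // !signed_actK.
rewrite signed_act_braid3 ?signed_actK //; have := ltn_ord j; lia.
Qed.

Lemma signed_word_equiv w1 w2 : cox_equiv (affineC_matrix n) w1 w2 ->
  signed_word w1 =1 signed_word w2.
Proof.
elim=> [//|w3 w4 _ IH x|w3 w4 w5 _ h1 _ h2 x|u1 u2 v1 v2 _ h1 _ h2 x|s t x].
- by rewrite IH.
- by rewrite h1.
- by rewrite /signed_word !foldr_cat [X in foldr _ X]h2 [LHS]h1.
- exact: signed_word_rel.
Qed.

Lemma word_val_signed (w1 w2 : seq 'I_n.+1) x :
  word_val (affineC_matrix n) w1 = word_val (affineC_matrix n) w2 ->
  signed_word w1 x = signed_word w2 x.
Proof. by move=> /cox_equivP/signed_word_equiv. Qed.

Definition adjacent (i j : nat) := (i.+1 == j) || (j.+1 == i).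

(** The point (+, i-1), or (+, 0) for i = 0, is moved by i, and its image
    determines i. *)
Lemma affineC_gen_inj : injective (cox_gen (affineC_matrix n)).
Proof.
move=> i j; rewrite -!word_val_seq1 => /(@word_val_signed _ _ (false, i.-1)) /=.
have ltj := ltn_ord j; have lti := ltn_ord i.
move=> e; apply: val_inj; move: e; rewrite /signed_act /=.
split_eqs;
  move=> e; have := congr1 fst e; have := congr1 snd e => /=; clear e; lia.
Qed.

Lemma affineC_m_adjacent (i j : 'I_n.+1) : (2 < affineC_m i j) = adjacent i j.
Proof.
rewrite /affineC_m /adjacent; have [->|] := eqVneq i j; first by lia.
by move=> _; case: ifP => //; case: ifP.
Qed.

Lemma affineC_m_le4 (i j : 'I_n.+1) : i != j -> 1 < affineC_m i j <= 4.
Proof. by rewrite /affineC_m => /negbTE ->; do 2?case: ifP. Qed.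

Lemma affineC_noncomm (i j : 'I_n.+1) : 2 < affineC_m i j ->
  ~ commute (cox_gen (affineC_matrix n) i) (cox_gen (affineC_matrix n) j).
Proof.
rewrite affineC_m_adjacent => a c.
wlog e : i j a c / i.+1 = j => [hw|].
  by case/orP: (a) => /eqP e; [apply: hw e|apply: hw e => //]; rewrite // /adjacent orbC.
have /(@word_val_signed _ _ (false, val i)) :
    word_val (affineC_matrix n) [:: i; j] = word_val (affineC_matrix n) [:: j; i].
  by rewrite !word_val_cons word_val_nil !mulg1.
have lj := ltn_ord j; rewrite /= -e in lj *; rewrite /signed_act /=; clear c.
split_eqs; by case; lia.
Qed.

Lemma affineC_commE (i j : 'I_n.+1) :
  commute (cox_gen (affineC_matrix n) i) (cox_gen (affineC_matrix n) j) <->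
  ~~ adjacent i j.
Proof.
rewrite -affineC_m_adjacent; split=> [c|nadj].
  by apply/negP => /affineC_noncomm.
have [->|ne] := eqVneq i j; first exact: commute_refl.
by apply: gen_comm => /=; have := affineC_m_le4 ne; lia.
Qed.
End SignedPermutations.

(** * The three types of words avoid braids *)

Section Zigzag.
Variable n : nat.
Hypothesis n_ge2 : 2 <= n.

(** The triangular wave of period 2n going up from 0 to n and back. *)
Definition zigzag_val (k : nat) : nat :=
  let r := k %% n.*2 in if r <= n then r else n.*2 - r.

Lemma zigzag_modS k :
  k.+1 %% n.*2 = if (k %% n.*2).+1 == n.*2 then 0 else (k %% n.*2).+1.
Proof.
rewrite modnS; have lt : k %% n.*2 < n.*2 by rewrite ltn_mod; lia.
rewrite /dvdn -addn1 -modnDml; case: eqP => e; last first.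
  by case: eqP => // e'; case: e; rewrite addn1 e' modnn.
case: eqP => // e'; move: e; rewrite modn_small; lia.
Qed.

Ltac if_cases :=
  repeat (match goal with |- context [if ?b then _ else _] =>
    lazymatch b with context [if _ then _ else _] => fail | _ => idtac end;
    case: (boolP b) => ? end).

Ltac zigzag_cases k :=
  have : k %% n.*2 < n.*2 by rewrite ltn_mod; lia.

Lemma zigzag_val_le k : zigzag_val k <= n.
Proof. zigzag_cases k; rewrite /zigzag_val; case: ifP; lia. Qed.

Lemma zigzag_val_up k : k <= n -> zigzag_val k = k.
Proof. by move=> lk; rewrite /zigzag_val modn_small ?lk; lia. Qed.

Lemma zigzag_val_down k : k <= n -> zigzag_val (n.*2 - k) = k.
Proof.
case: k => [|k] lk; first by rewrite subn0 /zigzag_val modnn.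
by rewrite /zigzag_val modn_small; [case: ifP|]; lia.
Qed.

Lemma zigzag_val_adjacent k : adjacent (zigzag_val k) (zigzag_val k.+1).
Proof.
zigzag_cases k; rewrite /zigzag_val zigzag_modS /adjacent /=; move: (k %% _) => r.
by if_cases; lia.
Qed.

Lemma zigzag_val_turn k : zigzag_val k = zigzag_val k.+2 <->
  zigzag_val k.+1 = 0 \/ zigzag_val k.+1 = n.
Proof.
zigzag_cases k; rewrite /zigzag_val !zigzag_modS /=; move: (k %% _) => r.
by if_cases; lia.
Qed.

(** Two consecutive values determine the position in the period, since a single
    value leaves open whether the wave is rising or falling. *)
Lemma zigzag_val_inj2 j k : zigzag_val j = zigzag_val k ->
  zigzag_val j.+1 = zigzag_val k.+1 -> j = k %[mod n.*2].
Proof.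
zigzag_cases k; zigzag_cases j; rewrite /zigzag_val !zigzag_modS /=.
move: (k %% _) (j %% _) => r r'.
by if_cases; lia.
Qed.

Lemma size_zigzag_period : size (zigzag_period n) = n.*2.
Proof. by rewrite size_map size_cat size_rev !size_iota; lia. Qed.

Lemma zigzagE k : zigzag n k = zigzag_val k :> nat.
Proof.
rewrite /zigzag size_zigzag_period /zigzag_val /=; zigzag_cases k.
move: (k %% _) => r lr.
rewrite (nth_map 0) ?size_cat ?size_rev ?size_iota; last by lia.
rewrite nth_cat size_iota; case: ifP => h.
  by rewrite nth_iota // inordK; [case: ifP|]; lia.
rewrite nth_rev ?size_iota; last lia.
rewrite nth_iota; last lia.
by rewrite inordK; [case: ifP|]; lia.
Qed.

Lemma zigzag_modE j k : j = k %[mod n.*2] -> zigzag n j = zigzag n k.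
Proof. by move=> e; rewrite /zigzag size_zigzag_period e. Qed.

Lemma zigzag_subword_cat (A B : seq 'I_n.+1) :
  zigzag_subword (A ++ B) -> zigzag_subword B.
Proof.
case=> k; rewrite size_cat iotaD map_cat => e; exists (k + size A).
by have /(congr1 (drop (size A))) := e; rewrite !drop_size_cat // size_map size_iota.
Qed.

Lemma zigzag_factor_adjacent (A B : seq 'I_n.+1) s t :
  zigzag_subword (A ++ [:: s, t & B]) -> adjacent s t.
Proof.
by move=> /zigzag_subword_cat[k /= [-> ->]] _; rewrite !zigzagE zigzag_val_adjacent.
Qed.

Lemma zigzag_factor_turn A B (s t : 'I_n.+1) : zigzag_subword (A ++ [:: s, t, s & B]) ->
  t = 0 :> nat \/ t = n :> nat.
Proof.
move=> /zigzag_subword_cat[k /= [e1 -> e2 _]]; rewrite !zigzagE.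
by apply/zigzag_val_turn; rewrite -!zigzagE -e1 -e2.
Qed.

(** The interior letter p has a neighbour other than q, and no occurrence of it
    separates the two occurrences of p. *)
Lemma alternating_factor A B (p q : 'I_n.+1) : 0 < p < n -> adjacent p q ->
  alternating (A ++ [:: p, q, p & B]) -> False.
Proof.
move=> lp a alt; have lq := ltn_ord q.
case/orP: a => /eqP a.
  have li : p.-1 < n.+1 by lia.
  have := alt (Ordinal li) p; rewrite /= prednK; last lia.
  move=> /(_ erefl); rewrite filter_cat /= !inE -!val_eqE /= !eqxx !orbT.
  have -> : (q == p.-1 :> nat) = false by lia.
  have -> : (q == p :> nat) = false by lia.
  by case/cat_sorted2 => _ /=; rewrite eqxx.
have li : p.+1 < n.+1 by lia.
have := alt p (Ordinal li) erefl; rewrite filter_cat /= !inE -!val_eqE /= !eqxx.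
have -> : (q == p.+1 :> nat) = false by lia.
have -> : (q == p :> nat) = false by lia.
by case/cat_sorted2 => _ /=; rewrite eqxx.
Qed.

Lemma alternating_square A B (p : 'I_n.+1) : ~ alternating (A ++ [:: p, p & B]).
Proof.
move=> alt; have lp := ltn_ord p.
have [ltp|lep] := ltnP p n.
  have := alt p (Ordinal (ltp : p.+1 < n.+1)) erefl; rewrite filter_cat /= !inE !eqxx.
  by case/cat_sorted2 => _ /=; rewrite eqxx.
have li : p.-1 < n.+1 by lia.
have := alt (Ordinal li) p; rewrite /= prednK; last lia.
move=> /(_ erefl); rewrite filter_cat /= !inE !eqxx !orbT.
by case/cat_sorted2 => _ /=; rewrite eqxx.
Qed.

Lemma cfc_condition_no_braid (w : seq 'I_n.+1) :
  cfc_condition w -> ~ has_braid (affineC_matrix n) w.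
Proof.
move=> cw hb; case: hb cw => {w} [A C s|A C s t _ hm].
  case=> [/(_ s)|[/alternating_square //] _|[/zigzag_factor_adjacent h _]].
    by rewrite count_cat /= eqxx; lia.
  by move: h; rewrite /adjacent; lia.
have adj : adjacent s t by rewrite -affineC_m_adjacent.
have adj' : adjacent t s by rewrite /adjacent orbC.
have [[e [ls lt]]|e] : (alternating_braid (affineC_matrix n) s t = [:: s; t; s] /\
    (0 < s < n /\ 0 < t < n)) \/
    alternating_braid (affineC_matrix n) s t = [:: t; s; t; s].
- rewrite /alternating_braid /= /affineC_m.
  have lss := ltn_ord s; have ltt := ltn_ord t.
  have -> : (s == t) = false by apply/eqP => h; move: adj; rewrite h /adjacent; lia.
  move: adj; rewrite /adjacent => h; rewrite h; case: ifP => h'; [by right|left].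
  by split=> //; move: h'; rewrite /minn /maxn; case: ifP; lia.
- rewrite e; case=> [/(_ s)|[alt _]|[/zigzag_factor_turn h _]].
  + by rewrite count_cat /= eqxx; lia.
  + exact: alternating_factor ls adj alt.
  + by case: h; lia.
rewrite e; case=> [/(_ s)|[alt _]|[zz _]].
- by rewrite count_cat /= eqxx; lia.
- have [hs|hs] := boolP (0 < s < n).
    by apply: (@alternating_factor (A ++ [:: t]) C s t); rewrite // -catA.
  apply: (@alternating_factor A (s :: C) t s) => //.
  have lss := ltn_ord s; have ltt := ltn_ord t; move: adj hs; rewrite /adjacent; lia.
- have h1 := zigzag_factor_turn zz.
  have /zigzag_factor_turn h2 : zigzag_subword ((A ++ [:: t]) ++ [:: s, t, s & C]).
    by rewrite -catA.
  have lss := ltn_ord s; have ltt := ltn_ord t; move: adj; rewrite /adjacent; lia.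
Qed.

(** Counts are invariant under commutations, and so are the projections on
    pairs of adjacent letters.  A zigzag word admits no commutation at all,
    since its consecutive letters are adjacent in the diagram. *)
Lemma cfc_condition_comm (w w' : seq 'I_n.+1) :
  commutation_equiv (affineC_matrix n) w w' ->
  cfc_condition w -> cfc_condition w'.
Proof.
move=> ce; have /permP pe := commutation_perm ce.
case=> [c|[alt [c lc hc]]|[zz [c lc hc]]].
- by apply: Or31 => s; rewrite -pe.
- apply: Or32; split; last by exists c => // s; rewrite -pe.
  move=> i j e; rewrite -(commutation_project _ ce); first exact: alt.
  by move=> _ /(affineC_commE n_ge2); rewrite /adjacent e eqxx.
- apply: Or33; split; last first.
    by exists c => //; case: hc => h1 h2 h3; split=> [s /h1||]; rewrite -pe.
  elim: ce zz {pe hc} => // u v w0 s t /(affineC_commE n_ge2) nadj _ _.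
  by move=> /zigzag_factor_adjacent h; rewrite h in nadj.
Qed.
End Zigzag.

(** * Rotations of words of the three types *)

Lemma count_alternating_path (T : eqType) (a b : T) P : a != b ->
  all [in [:: a; b]] P -> path (fun x y => x != y) a P ->
  count_mem a (a :: P) = count_mem b (a :: P) + (last a P == a).
Proof.
elim: P a b => [|x P IH] a b ab; first by rewrite /= !eqxx (negbTE ab).
move=> /= /andP[]; rewrite !inE => /orP[] /eqP-> aP /andP[ax pP].
  by rewrite eqxx in ax.
have aP' : all [in [:: b; a]] P by apply: sub_all aP => y; rewrite !inE orbC.
have := IH b a; rewrite eq_sym ab => /(_ isT aP' pP) /= ->.
rewrite !eqxx (negbTE ax) (eq_sym b a) (negbTE ax).
have : last b P \in [:: a; b].
  have : all [in [:: a; b]] (b :: P) by rewrite /= aP !inE eqxx orbT.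
  by move/allP; apply; apply: mem_last.
rewrite !inE => /orP[] /eqP ->;
  rewrite ?eqxx ?(negbTE ab) ?(negbTE ax) ?(eq_sym b a) ?(negbTE ab); lia.
Qed.

(** An alternating word with equally many a and b has distinct end letters, so
    it also alternates cyclically. *)
Lemma sorted_neq_catC (T : eqType) (a b : T) (X Y : seq T) : a != b ->
  all [in [:: a; b]] (X ++ Y) -> count_mem a (X ++ Y) = count_mem b (X ++ Y) ->
  sorted (fun x y => x != y) (X ++ Y) -> sorted (fun x y => x != y) (Y ++ X).
Proof.
move=> ab; case: X => [|x X]; first by rewrite cats0.
case: Y => [|y Y]; first by rewrite cats0.
rewrite /= => /andP[xab aXY]; rewrite -!/(count_mem _ (x :: _)) => e pXY.
have : x != last x (X ++ y :: Y).
  rewrite eq_sym; move: xab; rewrite !inE => /orP[] /eqP ex; subst x.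
    have := count_alternating_path ab aXY pXY; rewrite e.
    by case: eqP => //; lia.
  rewrite eq_sym in ab.
  have aXY' : all [in [:: b; a]] (X ++ y :: Y).
    by apply: sub_all aXY => z; rewrite !inE orbC.
  have := count_alternating_path ab aXY' pXY; rewrite -e.
  by case: eqP => //; lia.
move: pXY; rewrite !cat_path /= last_cat /= => /and3P[-> _ ->].
by rewrite eq_sym => ->.
Qed.

Section Rotation.
Variable n : nat.
Hypothesis n_ge2 : 2 <= n.
Implicit Types w u v : seq 'I_n.+1.

(** The counts add up to (n-1) c + c/2 + c/2 = n c, with c even. *)
Lemma size_zigzag_counts w c :
  (forall s : 'I_n.+1, 0 < s < n -> count_mem s w = c) ->
  2 * count_mem ord0 w = c -> 2 * count_mem ord_max w = c -> n.*2 %| size w.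
Proof.
move=> h h0 hN.
have -> : size w = \sum_(s < n.+1) count_mem s w.
  rewrite -sum1_size (partition_big id xpredT) //=.
  by apply: eq_bigr => i _; rewrite sum1_count; apply: eq_count => x; rewrite /= eq_sym.
case: n n_ge2 w c h h0 hN => // k k_gt0 w c h h0 hN.
rewrite big_ord_recl big_ord_recr /=.
have -> : lift ord0 (@ord_max k) = ord_max by apply: val_inj.
rewrite (eq_bigr (fun _ => c)) => [|i _]; last first.
  by apply: h => /=; rewrite /bump /= add1n !ltnS; apply: ltn_ord.
rewrite sum_nat_const card_ord; apply/dvdnP; exists (count_mem ord0 w).
have -> : count_mem ord_max w = count_mem ord0 w by lia.
rewrite -h0 -muln2; move: (count_mem ord0 w) => a; nia.
Qed.

(** For type (c), the length is a multiple of the period, so that the zigzag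
    continues across the place where the word is closed up. *)
Lemma cfc_condition_catC u v : cfc_condition (u ++ v) -> cfc_condition (v ++ u).
Proof.
have pe s : count_mem s (v ++ u) = count_mem s (u ++ v) by rewrite !count_cat addnC.
case=> [c|[alt [c lc hc]]|[zz [c lc hc]]].
- by apply: Or31 => s; rewrite pe.
- apply: Or32; split; last by exists c => // s; rewrite pe.
  move=> i j e; have := alt i j e; rewrite !filter_cat.
  have ne : i != j by rewrite -val_eqE /=; lia.
  have cf s : s \in [:: i; j] -> count_mem s [seq x <- u ++ v | x \in [:: i; j]] = c.
    move=> hs; rewrite count_filter -(hc s); apply: eq_count => x /=.
    by case: eqP => // ->.
  apply: (sorted_neq_catC ne); rewrite -filter_cat; first exact: filter_all.
  by rewrite !cf // !inE eqxx ?orbT.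
- apply: Or33; split; last first.
    by exists c => //; case: hc => h1 h2 h3; split=> [s /h1||]; rewrite pe.
  case: hc => h1 h2 h3; have := size_zigzag_counts h1 h2 h3; rewrite size_cat => dv.
  case: zz => k; rewrite size_cat iotaD map_cat => e; exists (k + size u).
  have eu : u = [seq zigzag n i | i <- iota k (size u)].
    by have /(congr1 (take (size u))) := e; rewrite !take_size_cat // size_map size_iota.
  have ev : v = [seq zigzag n i | i <- iota (k + size u) (size v)].
    by have /(congr1 (drop (size u))) := e; rewrite !drop_size_cat // size_map size_iota.
  rewrite size_cat iotaD map_cat -ev {1}eu; congr (_ ++ _).
  rewrite -addnA (addnC k) iotaDl -map_comp; apply: eq_map => i /=.
  by case/dvdnP: dv => q dv; apply: (zigzag_modE n_ge2); rewrite dv modnMDl.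
Qed.

Lemma cfc_condition_avoiding w : cfc_condition w -> braid_avoiding (affineC_matrix n) w.
Proof.
move=> cw w' e; exact: cfc_condition_no_braid (cfc_condition_comm n_ge2 e cw).
Qed.

Lemma cfc_condition_fc w : cfc_condition w ->
  reduced (affineC_matrix n) w /\
  (forall w', reduced (affineC_matrix n) w' ->
    word_val (affineC_matrix n) w' = word_val (affineC_matrix n) w ->
    commutation_equiv (affineC_matrix n) w w').
Proof.
move=> cw; apply: braid_avoiding_fc (cfc_condition_avoiding cw).
- exact: affineC_m_le4.
- exact: affineC_gen_inj.
- by move=> s t; apply: affineC_noncomm.
Qed.

Lemma cfc_condition_sufficient w : cfc_condition w ->
  cyclically_fully_commutative (word_val (affineC_matrix n) w).
Proof.
move=> cw w' [ev rw'] k.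
have [_ /(_ _ rw' ev) ww'] := cfc_condition_fc cw.
have crot : cfc_condition (rot k w').
  rewrite /rot; apply: cfc_condition_catC; rewrite cat_take_drop.
  exact: cfc_condition_comm ww' cw.
have [rr ur] := cfc_condition_fc crot; split=> // v v' [vv rv] [vv' rv'].
by apply: commutation_trans (ur _ rv' vv'); apply/commutation_sym/ur.
Qed.
End Rotation.

(** * Walks with the gap conditions *)

Definition gap (W : nat -> nat) s p q :=
  [/\ p < q, W p = s, W q = s & forall k, p < k < q -> W k <> s].

Lemma first_occurrence (P : pred nat) p q : (exists2 k, p < k < q & P k) ->
  exists2 k, p < k < q /\ P k & forall l, p < l < k -> ~~ P l.
Proof.
case=> k0 hk0 Pk0.
have ex : exists k, (p < k < q) && P k by exists k0; rewrite hk0.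
case: (ex_minnP ex) => k /andP[hk Pk] kmin; exists k => // l hl.
by apply/negP => Pl; have := kmin l; rewrite Pl andbT; lia.
Qed.

Lemma last_occurrence (P : pred nat) p q : (exists2 k, p <= k < q & P k) ->
  exists2 k, p <= k < q /\ P k & forall l, k < l < q -> ~~ P l.
Proof.
case=> k0 hk0 Pk0.
have ex : exists k, (p <= k < q) && P k by exists k0; rewrite hk0.
have bd k : (p <= k < q) && P k -> k <= q by lia.
case: (ex_maxnP ex bd) => k /andP[hk Pk] kmax; exists k => // l hl.
by apply/negP => Pl; have := kmax l; rewrite Pl andbT; lia.
Qed.

(** The properties of the periodic walk of a CFC word that the combinatorial
    argument uses.  The bounds by p + N keep the positions involved inside
    one rotation of the word, so that they are distinct positions of it.
    walk_gap excludes squares, walk_gap2 the factors s t s with m(s,t) = 3,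
    and walk_braid4 the factors s t s t with m(s,t) = 4, up to
    commutations. *)
Record cfc_walk (n N : nat) (W : nat -> nat) : Prop := CfcWalk {
  walk_le : forall k, W k <= n;
  walk_per : forall k, W (k + N) = W k;
  walk_gap : forall s p q, gap W s p q -> q < p + N ->
    exists2 k, p < k < q & adjacent s (W k);
  walk_gap2 : forall s p q k, gap W s p q -> q < p + N -> 0 < s < n ->
    p < k < q -> adjacent s (W k) -> 0 < W k < n ->
    exists2 k', p < k' < q & k' <> k /\ adjacent s (W k');
  walk_braid4 : forall s t p q k r, gap W s p q -> q < p + N ->
    adjacent s t -> t = 0 \/ t = n -> 0 < s < n ->
    gap W t k r -> p < k < q -> q < r -> r < p + N ->
    (forall k', p < k' < q -> adjacent s (W k') -> k' = k) ->
    (forall l, q < l < r -> W l <> s) -> False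
}.

Section Walk.
Variables (n N : nat).
Hypothesis n_ge2 : 2 <= n.

(** The diagram automorphism exchanging t and u, which halves the work on
    turns. *)
Lemma cfc_walk_flip W : cfc_walk n N W -> cfc_walk n N (fun k => n - W k).
Proof.
case=> le per A1 A2 A3.
have gapF s p q : gap (fun k => n - W k) s p q -> s <= n /\ gap W (n - s) p q.
  case=> lpq ep eq nk; have := le p; have := le q; split; first lia.
  split=> //; try lia.
  by move=> k /nk; have := le k; lia.
split=> [k|k|s p q|s p q k|s t p q k r].
- lia.
- by rewrite per.
- case/gapF=> ls /A1 h /h [k hk a]; exists k => //; move: a; rewrite /adjacent.
  by have := le k; lia.
- case/gapF=> ls gs lq hs hk a hWk.
  have lk := le k.
  have [|//|||k' hk' [ne a']] := A2 _ _ _ k gs lq; rewrite /adjacent in a *; try lia.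
  by exists k' => //; split=> //; move: a'; rewrite /adjacent; have := le k'; lia.
- case/gapF=> ls gs lq a ht hs /gapF[lt gt] hk lr lrN u1 u2.
  apply: (A3 _ _ _ _ _ _ gs lq _ _ _ gt hk lr lrN); rewrite /adjacent in a *; try lia.
    move=> k' hk' ak; apply: u1 => //; move: ak; rewrite /adjacent.
    by have := le k'; lia.
  by move=> l /u2; have := le l; lia.
Qed.

Section Turns.
Variable W : nat -> nat.
Hypothesis walkW : cfc_walk n N W.

Definition multi s := exists p q, [/\ p < q < p + N, W p = s & W q = s].

Lemma walk_perM j k : W (k + j * N) = W k.
Proof.
by elim: j => [|j IH]; rewrite ?addn0 // mulSn addnCA addnC (walk_per walkW) IH.
Qed.

(** Otherwise the gap would be [p, p + N], and no other position modulo N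
    could carry the letter s. *)
Lemma multi_gap s p q : multi s -> gap W s p q -> q < p + N.
Proof.
case=> a [b [hab ea eb]] [lpq ep eq nk].
have N0 : 0 < N by lia.
have rep x : exists2 y, p < y <= p + N & exists i j, y + i * N = x + j * N.
  pose d := x + p.+1 * N - p.+1; exists (p.+1 + d %% N).
    by have := ltn_pmod d N0; lia.
  by exists (d %/ N), p.+1; have := divn_eq d N; rewrite /d; nia.
have [a' ha' [i [j e]]] := rep a; have [b' hb' [i' [j' e']]] := rep b.
have Wa : W a' = s by rewrite -(walk_perM i) e walk_perM.
have Wb : W b' = s by rewrite -(walk_perM i') e' walk_perM.
(* a and b differ by less than N, so they are incongruent modulo N. *)
have ne : a' <> b'.
  have [h|h] := leqP (j + i') (j' + i).
    have := leq_mul h (leqnn N); rewrite !mulnDl; lia.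
  have := leq_mul h (leqnn N); rewrite mulSn !mulnDl; lia.
rewrite ltnNge; apply/negP => leq.
have := nk a'; have := nk b'; rewrite Wa Wb; lia.
Qed.

Lemma next_gap s p : W p = s -> 0 < N -> exists q, gap W s p q.
Proof.
move=> e N0.
have [|q [hq /eqP eq] nq] := @first_occurrence (fun k => W k == s) p (p + N).+1.
  by exists (p + N); rewrite ?(walk_per walkW) ?e //; lia.
exists q; split=> // [|k /nq/eqP //]; lia.
Qed.

Definition upper p q i := gap W i p q /\ forall k, p < k < q -> W k <> i.-1.
Definition lower p q i := gap W i p q /\ forall k, p < k < q -> W k <> i.+1.

(** Without i-1, the two neighbours of i which a gap must contain are both i+1;
    the last two of them enclose no i. *)
Lemma upper_two i p q : 0 < i -> i.+1 < n -> multi i -> upper p q i ->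
  exists a b, [/\ p < a & b < q] /\ upper a b i.+1 /\
    (forall k, b < k < q -> W k <> i.+1).
Proof.
move=> i0 iN mi [gi nu]; have lq := multi_gap mi gi.
have [k hk ak] := walk_gap walkW gi lq.
have ek : W k = i.+1 by move: ak (nu k hk); rewrite /adjacent; lia.
have int : 0 < i < n by lia.
have intk : 0 < W k < n by rewrite ek; lia.
have [k' hk' [ne ak']] := walk_gap2 walkW gi lq int hk ak intk.
have ek' : W k' = i.+1 by move: ak' (nu k' hk'); rewrite /adjacent; lia.
have [|b [hb /eqP eb] nb] := @last_occurrence (fun k => W k == i.+1) p.+1 q.
  by exists k; rewrite ?ek.
have [|a [ha /eqP ea] na] := @last_occurrence (fun k => W k == i.+1) p.+1 b.
  have := nb k; have := nb k'; rewrite ek ek' eqxx => h h'.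
  have [lt|le] := ltnP k b; first by exists k; rewrite ?ek //; lia.
  exists k'; rewrite ?ek' //; have := hk'; have := hk; lia.
exists a, b; split; first by lia.
split; last by move=> l /nb/eqP.
case: gi => _ _ _ ni; split; last by move=> l hl; apply: ni; lia.
by split=> // [|l /na /eqP //]; lia.
Qed.

(** Downward induction on i.  If i = n-1, the upper gap contains u exactly once;
    another u in the next gap would give the factor s u s u, with s = s_(n-1).
    If i < n-1, the last two occurrences of i+1 in the upper gap form an upper
    gap of i+1, and if i+1 also occurred in the next gap of i, the following gap
    of i+1 would contain no i+2 by induction and only the one i that separates
    the two gaps: a factor s t s with m(s,t) = 3. *)
Lemma upper_next i p q r : 0 < i < n -> multi i -> upper p q i -> gap W i q r ->
  lower q r i.
Proof.
move=> hi; have [d] := ubnP (n - i); elim: d i p q r hi => // d IH i p q r hi ld mi up gr.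
split=> // l hl el.
have [|l1 [hl1 /eqP el1] nl1] := @first_occurrence (fun k => W k == i.+1) q r.
  by exists l; rewrite ?el.
have lq := multi_gap mi up.1; have lr := multi_gap mi gr.
have [[lpq ep eq ni] nu] := up; have [lqr _ er ni'] := gr.
have [lt|le] := ltnP i.+1 n; last first.
  have [k hk ak] := walk_gap walkW up.1 lq.
  have ek : W k = n by move: ak (nu k hk); rewrite /adjacent; lia.
  have ki : i.+1 = n by lia.
  have noi x y : p < x -> x < y -> y < q -> W x = n -> W y = n -> False.
    move=> px xy yq ex ey.
    have [|z [hz /eqP ez] nz] := @first_occurrence (fun k => W k == n) x y.+1.
      by exists y; rewrite ?ey ?eqxx //; lia.
    have gz : gap W n x z by split=> // [|o /nz/eqP //]; lia.
    have [|o ho ao] := walk_gap walkW gz; first by lia.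
    have := ni o; have := walk_le walkW o; move: ao; rewrite /adjacent; lia.
  have uniq k' : p < k' < q -> adjacent i (W k') -> k' = k.
    move=> hk' ak'; have ek' : W k' = n.
      by move: ak' (nu k' hk'); rewrite /adjacent; lia.
    by have [lt'|lt'|//] := ltngtP k' k; [case: (@noi k' k)|case: (@noi k k')]; lia.
  have gn : gap W n k l1.
    split=> //; [lia|lia|move=> x hx ex].
    have [lx|lx|ex'] := ltngtP x q.
    - by apply: (@noi k x); lia.
    - by have := nl1 x; rewrite ki ex eqxx; lia.
    - by move: ex; rewrite ex'; lia.
  have lrN : l1 < p + N.
    have := ni' (p + N); rewrite (walk_per walkW); lia.
  apply: (walk_braid4 walkW up.1 lq _ _ _ gn hk) => //; try lia.
    by rewrite /adjacent ki eqxx.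
  by move=> o ho; apply: ni'; lia.
have [|a [b [[pa bq] [[gab nab] nb]]]] := upper_two _ lt mi up; first by lia.
have [lab ea eb nab1] := gab.
have gbl : gap W i.+1 b l1.
  split=> //; first by lia.
  move=> x hx; have [lx|lx|->] := ltngtP x q; last by rewrite eq; lia.
    by apply: nb; lia.
  by apply/eqP/nl1; lia.
have mi1 : multi i.+1 by exists a, b; split=> //; lia.
have [_ nbl] : lower b l1 i.+1.
  by apply: (IH i.+1 a b l1) => //; lia.
(* The only neighbour of i+1 between b and l1 is the i at position q. *)
have lbl := multi_gap mi1 gbl.
have [|||| k' hk' [ne ak']] := walk_gap2 walkW gbl lbl _ (k := q);
  rewrite ?eq /adjacent ?eqxx ?orbT //; try lia.
have ek' : W k' = i by move: ak' (nbl k' hk'); rewrite /adjacent; lia.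
have [lk|lk] : k' < q \/ q < k' by lia.
  by apply: (ni k'); lia.
by apply: (ni' k'); lia.
Qed.
End Turns.

Section Flip.
Variable W : nat -> nat.
Hypothesis walkW : cfc_walk n N W.
Let W' k := n - W k.

Lemma gap_flip s p q : s <= n -> gap W' (n - s) p q <-> gap W s p q.
Proof.
move=> ls; rewrite /W'; have le := walk_le walkW.
split=> -[lpq ep eq nk]; have := le p; have := le q; split=> //; try lia.
  by move=> k /nk; have := le k; lia.
by move=> k /nk; have := le k; lia.
Qed.

Lemma upper_flip i p q : i < n -> upper W' p q (n - i) <-> lower W p q i.
Proof.
move=> ls; rewrite /upper /lower gap_flip; last lia.
by split=> -[g h]; split=> // k /h; rewrite /W'; have := walk_le walkW k; lia.
Qed.

Lemma lower_flip i p q : 0 < i <= n -> lower W' p q (n - i) <-> upper W p q i.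
Proof.
move=> ls; rewrite /upper /lower gap_flip; last lia.
by split=> -[g h]; split=> // k /h; rewrite /W'; have := walk_le walkW k; lia.
Qed.

Lemma multi_flip i : i <= n -> multi W i -> multi W' (n - i).
Proof. by move=> li [p [q [h e e']]]; exists p, q; rewrite /W' e e'. Qed.

Lemma lower_next i p q r : 0 < i < n -> multi W i -> lower W p q i ->
  gap W i q r -> upper W q r i.
Proof.
move=> hi mi lo g; apply/lower_flip; first lia.
apply: (upper_next (cfc_walk_flip walkW) (p := p)); first lia.
- by apply: multi_flip => //; lia.
- by apply/upper_flip => //; lia.
- by apply/gap_flip => //; lia.
Qed.

Lemma lower_two i p q : 1 < i < n -> multi W i -> lower W p q i ->
  exists a b, [/\ p < a & b < q] /\ lower W a b i.-1.
Proof.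
move=> hi mi lo.
have [|||| a [b [hab [u _]]]] :=
  upper_two (cfc_walk_flip walkW) (i := n - i) (p := p) (q := q).
- lia.
- lia.
- by apply: multi_flip => //; lia.
- by apply/upper_flip => //; lia.
exists a, b; split=> //; apply/upper_flip; first lia.
by have -> : n - i.-1 = (n - i).+1 by lia.
Qed.
End Flip.

Section Turning.
Variable W : nat -> nat.
Hypothesis walkW : cfc_walk n N W.

(** Existence of an upper gap, the direction being immaterial since upper
    and lower gaps follow each other. *)
Definition turning i := multi W i /\ exists p q, upper W p q i.

Lemma multi_N i : multi W i -> 0 < N.
Proof. by case=> p [q [h _ _]]; lia. Qed.

Lemma turning_lower i : 0 < i < n -> turning i -> exists p q, lower W p q i.
Proof.
move=> hi [mi [p [q up]]]; have [[_ _ eq _] _] := up.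
have [r g] := next_gap walkW eq (multi_N mi).
by exists q, r; apply: upper_next up g.
Qed.

Lemma lower_turning i p q : 0 < i < n -> multi W i -> lower W p q i -> turning i.
Proof.
move=> hi mi lo; have [[_ _ eq _] _] := lo.
have [r g] := next_gap walkW eq (multi_N mi).
by split=> //; exists q, r; apply: lower_next lo g.
Qed.

Lemma gap_multi i p q : gap W i p q -> q < p + N -> multi W i.
Proof. by case=> lpq ep eq _ lq; exists p, q; split=> //; lia. Qed.

Lemma turning_up i : 0 < i -> i.+1 < n -> turning i -> turning i.+1.
Proof.
move=> i0 iN [mi [p [q up]]].
have [a [b [[pa bq] [u _]]]] := upper_two walkW i0 iN mi up.
have lq := multi_gap walkW mi up.1.
by split; [apply: gap_multi u.1 _; lia|exists a, b].
Qed.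

Lemma turning_down i : 1 < i < n -> turning i -> turning i.-1.
Proof.
move=> hi t; have [|p [q lo]] := turning_lower _ t; first lia.
have [a [b [[pa bq] l]]] := lower_two walkW hi t.1 lo.
have lq := multi_gap walkW t.1 lo.1.
by apply: (lower_turning _ _ l); [lia|apply: (gap_multi l.1); lia].
Qed.

(** Upper gaps contain upper gaps of the next letter, which moves turns up the
    diagram; lower gaps, which follow them, contain lower gaps of the previous
    letter, which moves turns down. *)
Lemma turning_all i j : 0 < i < n -> 0 < j < n -> turning i -> turning j.
Proof.
move=> hi hj t.
have t1 : turning 1.
  elim: i hi t => // i IH hi t; case: (posnP i) t => [-> //|i0] t.
  by apply: IH; [lia|apply: (turning_down _ t); lia].
elim: j hj => // j IH hj; case: (posnP j) => [-> //|j0].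
by apply: turning_up => //; apply: IH; lia.
Qed.

Lemma gap_inj i p q q' : gap W i p q -> gap W i p q' -> q = q'.
Proof.
case=> l _ e n1 [l' _ e' n2]; have [h|h|//] := ltngtP q q'.
  by case: (n2 q); lia.
by case: (n1 q'); lia.
Qed.

Lemma gap_shift i p q j : gap W i p q <-> gap W i (p + j * N) (q + j * N).
Proof.
have per := walk_perM walkW j.
split=> -[l e e' nk].
  split; rewrite ?per //; first lia.
  move=> k hk; rewrite -(subnK (_ : j * N <= k)) ?per; last lia.
  by apply: nk; lia.
split; rewrite -?(per p) -?(per q) //; first lia.
by move=> k hk; rewrite -per; apply: nk; lia.
Qed.

Lemma turning_gap i p q : 0 < i < n -> turning i -> gap W i p q ->
  upper W p q i \/ lower W p q i.
Proof.
move=> hi [mi [p0 [q0 up]]].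
wlog lp : p q / p0 <= p => [hw g|].
  have g' : gap W i (p + p0 * N) (q + p0 * N) by apply: (proj1 (gap_shift _ _ _ p0) g).
  have [|[_ h]|[_ h]] := hw _ _ _ g'; first by have := multi_N mi; nia.
    left; split=> // k hk; rewrite -(walk_perM walkW p0); apply: h; lia.
  right; split=> // k hk; rewrite -(walk_perM walkW p0); apply: h; lia.
elim/ltn_ind: p q lp => p IH q lp g.
have [e|ne] := eqVneq p p0.
  by subst p; rewrite (gap_inj g up.1); left.
have [_ ep _ _] := g; have [[_ ep0 _ _] _] := up.
have [|p' [hp' /eqP ep'] np'] := @last_occurrence (fun k => W k == i) p0 p.
  by exists p0; [lia|apply/eqP].
have g' : gap W i p' p by split=> // [|k /np'/eqP //]; lia.
have [||u|l] := IH p' _ p _ g'; try lia.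
  by right; apply: upper_next u g.
by left; apply: lower_next l g.
Qed.

(** The shift by a period ensures that there is an occurrence of s
    before the given position. *)
Lemma surround s x k : 0 < N -> W x = s -> W k <> s ->
  exists p q, gap W s p q /\ p < k + N < q.
Proof.
move=> N0 ex nk; pose x' := x %% N.
have ex' j : W (x' + j * N) = s.
  by rewrite (walk_perM walkW) // /x' -(walk_perM walkW (x %/ N)) addnC -divn_eq.
have lx : x' < N by rewrite ltn_mod.
have [|p [hp /eqP ep] np] := @last_occurrence (fun j => W j == s) 0 (k + N).
  exists x'; last by have := ex' 0; rewrite addn0 => ->.
  lia.
have [|q [hq /eqP eq] nq] := 
  @first_occurrence (fun j => W j == s) (k + N) (x' + (k + N).+1 * N).+1.
  by exists (x' + (k + N).+1 * N); [nia|rewrite ex'].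
exists p, q; split; last lia.
split=> //; first lia.
move=> j hj; have [h|h|->] := ltngtP j (k + N).
- by apply/eqP/np; lia.
- by apply/eqP/nq; lia.
by rewrite (walk_per walkW).
Qed.

(** The gap contains no i-1, so it lies inside a gap of i-1.  The latter
    contains i, hence is not lower, hence is upper and by induction contains no
    letter below i-1. *)
Lemma upper_ge i p q : turning 1 -> 0 < i < n -> upper W p q i ->
  forall k, p < k < q -> i <= W k.
Proof.
move=> t1; elim: i p q => // i IH p q hi up k hk.
have [i0|i0] := posnP i.
  by have := up.2 k hk; rewrite i0 /=; lia.
have hi' : 0 < i < n by lia.
have N0 := multi_N t1.1.
have ti : turning i by apply: turning_all t1; lia.
have [x0 [y0 [_ ex0 _]]] := ti.1.
have [_ ep _ _] := up.1.
have [e|ne] := eqVneq (W k) i; first by case: (up.2 k hk).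
have [p' [q' [g hk']]] := surround N0 ex0 (elimN eqP ne).
have inside y : p <= y <= q -> p' < y + N < q'.
  move=> hy; have [_ ep' eq' _] := g; have [_ _ eq _] := up.1.
  have lp' : ~~ (p + N <= p').
    apply/negP => h; have := walk_per walkW (p' - N); rewrite subnK; last lia.
    have [e'|ne'] := eqVneq (p' - N) p; first by rewrite e' ep' ep; lia.
    by rewrite ep' => /esym; apply: up.2; lia.
  have lq' : ~~ (q' <= q + N).
    apply/negP => h; have := walk_per walkW (q' - N); rewrite subnK; last lia.
    have [e'|ne'] := eqVneq (q' - N) q; first by rewrite e' eq' eq; lia.
    by rewrite eq' => /esym; apply: up.2; lia.
  lia.
have [u|l] := turning_gap hi' ti g; last first.
  have := l.2 (p + N); rewrite (walk_per walkW) ep.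
  by have := inside p; case: up.1; lia.
by have := IH _ _ hi' u (k + N); rewrite (walk_per walkW); lia.
Qed.
End Turning.

Lemma turning_flip W i : cfc_walk n N W -> 0 < i < n -> turning W i ->
  turning (fun k => n - W k) (n - i).
Proof.
move=> wW hi t; split; first by apply: multi_flip t.1; lia.
have [p [q lo]] := turning_lower wW hi t.
by exists p, q; apply/upper_flip => //; lia.
Qed.

Section WalkSteps.
Variable W : nat -> nat.
Hypothesis walkW : cfc_walk n N W.
Hypothesis turn1 : turning W 1.

Let turnW i : 0 < i < n -> turning W i.
Proof. by move=> hi; apply: (turning_all walkW _ hi turn1); lia. Qed.

Lemma lower_leq i p q : 0 < i < n -> lower W p q i ->
  forall k, p < k < q -> W k <= i.
Proof.
move=> hi lo k hk.
have tF : turning (fun k => n - W k) 1.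
  have -> : 1 = n - n.-1 by lia.
  by apply: turning_flip => //; [lia|apply: turnW; lia].
have hi' : 0 < n - i < n by lia.
have up : upper (fun k => n - W k) p q (n - i) by apply/upper_flip => //; lia.
by have := upper_ge (cfc_walk_flip walkW) tF hi' up hk; have := walk_le walkW k; lia.
Qed.

Lemma turning_occurs s : 0 < s < n -> exists x, W x = s.
Proof. by move=> /turnW[[p [q [_ e _]]] _]; exists p. Qed.

(** If the walk jumped across s, the gap of s around the jump would contain
    letters on both sides of s. *)
Lemma walk_no_jump s k : 0 < s < n -> W k < s < W k.+1 \/ W k.+1 < s < W k -> False.
Proof.
move=> hs hk; have N0 := multi_N turn1.1.
have [x ex] := turning_occurs hs.
have [|p [q [g hpq]]] := surround walkW N0 ex (k := k); first lia.
have [_ _ eq _] := g.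
have hq : k.+1 + N < q.
  have : q <> k.+1 + N by move=> e; have := walk_per walkW k.+1; rewrite -e eq; lia.
  by lia.
have [u|l] := turning_gap walkW hs (turnW hs) g.
  have /(_ (k + N)) h1 := upper_ge walkW turn1 hs u.
  have /(_ (k.+1 + N)) h2 := upper_ge walkW turn1 hs u.
  by move: h1 h2; rewrite !(walk_per walkW); lia.
have /(_ (k + N)) h1 := lower_leq hs l.
have /(_ (k.+1 + N)) h2 := lower_leq hs l.
by move: h1 h2; rewrite !(walk_per walkW); lia.
Qed.

Lemma walk_adjacent k : adjacent (W k) (W k.+1).
Proof.
have N1 : 1 < N by have [[p [q [h _ _]]] _] := turn1; lia.
rewrite /adjacent; have lk := walk_le walkW k; have lk1 := walk_le walkW k.+1.
have [h|h|e] := ltngtP (W k) (W k.+1).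
- have := @walk_no_jump (W k).+1 k; lia.
- have := @walk_no_jump (W k.+1).+1 k; lia.
have g : gap W (W k) k k.+1 by split=> //; lia.
by have [|l hl] := walk_gap walkW g; lia.
Qed.

(** If the walk reversed at an interior letter s, the gaps of s before and after
    that position would be turns in the same direction. *)
Lemma walk_turn k : W k = W k.+2 -> W k.+1 = 0 \/ W k.+1 = n.
Proof.
move=> e; have := walk_le walkW k.+1; set s := W k.+1 => ls.
case: (posnP s) => [|s0]; [by left|right]; apply/eqP; rewrite eqn_leq ls leqNgt /=.
apply/negP => sn; have hs : 0 < s < n by lia.
have N0 := multi_N turn1.1.
have adj := walk_adjacent k; have adj' := walk_adjacent k.+1.
rewrite -/s /adjacent in adj adj'.
have [|p [q [g hpq]]] := surround walkW N0 (erefl s) (k := k); first lia.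
have [_ _ eq np] := g.
have eqq : q = k.+1 + N.
  have : ~ (k.+1 + N < q).
    by move=> h; have := np (k.+1 + N); rewrite (walk_per walkW) -/s; lia.
  lia.
have [r g'] := next_gap walkW eq N0; have [lr _ er _] := g'.
have hr : k.+2 + N < r.
  have : r <> k.+2 + N by move=> e'; have := walk_per walkW k.+2; rewrite -e' er; lia.
  by lia.
have mi := (turnW hs).1.
have [u|l] := turning_gap walkW hs (turnW hs) g.
  have l' := upper_next walkW hs mi u g'.
  have /(_ (k + N)) h1 := upper_ge walkW turn1 hs u.
  have /(_ (k.+2 + N)) h2 := lower_leq hs l'.
  by move: h1 h2; rewrite !(walk_per walkW); lia.
have u' := lower_next walkW hs mi l g'.
have /(_ (k + N)) h1 := lower_leq hs l.
have /(_ (k.+2 + N)) h2 := upper_ge walkW turn1 hs u'.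
by move: h1 h2; rewrite !(walk_per walkW); lia.
Qed.

Lemma walk_zigzag : exists a, forall k, W k = zigzag_val n (a + k).
Proof.
have [a e0 e1] : exists2 a, W 0 = zigzag_val n a & W 1 = zigzag_val n a.+1.
  have l0 := walk_le walkW 0; have l1 := walk_le walkW 1.
  have := walk_adjacent 0; rewrite /adjacent => adj.
  have [h|h] := leqP (W 1) (W 0).
    exists (n.*2 - W 0); first by rewrite zigzag_val_down.
    have -> : (n.*2 - W 0).+1 = n.*2 - W 1 by lia.
    by rewrite zigzag_val_down.
  exists (W 0); first by rewrite zigzag_val_up.
  have -> : (W 0).+1 = W 1 by lia.
  by rewrite zigzag_val_up.
exists a => k.
suff [] : W k = zigzag_val n (a + k) /\ W k.+1 = zigzag_val n (a + k).+1 by [].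
elim: k => [|k [IH1 IH2]]; first by rewrite addn0.
rewrite !addnS; split=> //.
have := zigzag_val_turn n_ge2 (a + k); have := @walk_turn k.
have := walk_adjacent k; have := walk_adjacent k.+1.
have := zigzag_val_adjacent n_ge2 (a + k); have := zigzag_val_adjacent n_ge2 (a + k).+1.
have := walk_le walkW k.+2; have := zigzag_val_le n_ge2 (a + k).+2.
rewrite -IH1 -IH2 /adjacent; lia.
Qed.
End WalkSteps.

Section Straight.
Variable W : nat -> nat.
Hypothesis walkW : cfc_walk n N W.
Hypothesis not_turn1 : ~ turning W 1.

(** A gap of s that misses a neighbour of s is a turn if s is interior, and
    contains no neighbour of s at all if s is an endpoint. *)
Lemma straight_gap s t p q : multi W s -> gap W s p q -> adjacent s t -> t <= n ->
  exists2 k, p < k < q & W k = t.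
Proof.
move=> ms g a lt; have lq := multi_gap walkW ms g; have [_ ep _ _] := g.
have ls : s <= n by rewrite -ep; apply: walk_le walkW _.
have noturn : 0 < s < n -> ~ turning W s.
  by move=> hs /(turning_all walkW hs) h; apply/not_turn1/h; lia.
have [[k hk ek]|no] := pselect (exists2 k, p < k < q & W k = t); first by exists k.
have no' k : p < k < q -> W k <> t by move=> hk ek; apply: no; exists k.
have [hs|hs] := boolP (0 < s < n); last first.
  have [k hk ak] := walk_gap walkW g lq; have := walk_le walkW k.
  have := no' k hk; rewrite /adjacent in a ak *; lia.
case: (noturn hs); case/orP: a => /eqP e.
  by apply: (lower_turning walkW hs ms (p := p) (q := q)); split=> //; rewrite e.
by split=> //; exists p, q; split=> //; rewrite -e.
Qed.

Lemma straight_multi_adjacent s t : multi W s -> adjacent s t -> t <= n -> multi W t.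
Proof.
move=> ms a lt; have N0 := multi_N ms; have [p [_ [_ ep _]]] := ms.
have [q g] := next_gap walkW ep N0; have [_ _ eq nk] := g.
have [r g'] := next_gap walkW eq N0; have [_ _ _ nk'] := g'.
have [k hk ek] := straight_gap ms g a lt.
have [k' hk' ek'] := straight_gap ms g' a lt.
have lq := multi_gap walkW ms g.
have lr : ~ p + N < r by move=> h; apply: (nk' (p + N)); rewrite ?(walk_per walkW); lia.
by exists k, k'; split=> //; lia.
Qed.

Lemma straight_multi s t : s <= n -> t <= n -> multi W s -> multi W t.
Proof.
move=> ls lt ms; have m0 : multi W 0.
  elim: s ls ms => // s IH ls ms; apply: IH; first lia.
  by apply: straight_multi_adjacent ms _ _; rewrite /adjacent; lia.
elim: t lt => // t IH lt; apply: straight_multi_adjacent (IH _) _ _ => //; first lia.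
by rewrite /adjacent eqxx.
Qed.

Lemma straight_between s t p q : (exists2 i, i <= n & multi W i) ->
  s <= n -> t <= n -> adjacent s t ->
  p < q -> W p = s -> W q = s -> exists2 k, p < k < q & W k = t.
Proof.
case=> i li mi ls lt a lpq ep eq; have ms := straight_multi li ls mi.
have [q' g] := next_gap walkW ep (multi_N mi); have [_ _ _ nk] := g.
have [k hk ek] := straight_gap ms g a lt; exists k => //.
have : ~ q < q' by move=> h; apply: (nk q); lia.
lia.
Qed.
End Straight.
End Walk.

(** * The walk of a CFC word *)

Section PeriodicWord.
Local Open Scope group_scope.
Variable n : nat.
Variable w : seq 'I_n.+1.
Hypothesis w_nonempty : 0 < size w.

Local Notation N := (size w).
Local Notation M := (affineC_matrix n).
Local Notation val := (word_val M).

Definition letter k : 'I_n.+1 := nth ord0 w (k %% N).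
Definition factor a b := [seq letter k | k <- iota a (b - a)].

Lemma factor_split a b c : a <= b < c ->
  factor a c = factor a b ++ letter b :: factor b.+1 c.
Proof.
move=> h; rewrite /factor; have -> : c - a = (b - a) + (c - b.+1).+1 by lia.
by rewrite iotaD map_cat /= subnKC //; lia.
Qed.

Lemma factor_cons a c : a < c -> factor a c = letter a :: factor a.+1 c.
Proof. by move=> h; rewrite (@factor_split a a c) ?leqnn // /factor subnn. Qed.

Lemma mem_factor a b x : x \in factor a b -> exists2 k, a <= k < b & x = letter k.
Proof. by case/mapP=> k; rewrite mem_iota => hk ->; exists k => //; lia. Qed.

Lemma size_factor a b : size (factor a b) = b - a.
Proof. by rewrite size_map size_iota. Qed.

Lemma factor_rot p : factor p (p + N) = rot (p %% N) w.
Proof.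
have lp : p %% N < N by rewrite ltn_mod.
apply: (@eq_from_nth _ ord0); first by rewrite size_factor size_rot addKn.
move=> i; rewrite size_factor addKn => hi.
rewrite (nth_map 0) ?size_iota ?addKn // nth_iota ?addKn // /rot nth_cat size_drop /letter.
rewrite -modnDml; case: ifP => h; first by rewrite nth_drop modn_small //; lia.
rewrite nth_take; last lia.
congr nth; have -> : p %% N + i = (i - (N - p %% N)) + N by lia.
by rewrite modnDr modn_small //; lia.
Qed.

Hypothesis n_ge2 : 2 <= n.

Lemma gen_comm_word (s : 'I_n.+1) B : {in B, forall x : 'I_n.+1, ~~ adjacent s x} ->
  commute (cox_gen M s) (val B).
Proof.
elim: B => [|x B IH] h; first by rewrite word_val_nil; apply: commute1.
rewrite word_val_cons; apply: commuteM.
  by apply/(affineC_commE n_ge2)/h; rewrite inE eqxx.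
by apply: IH => y hy; apply: h; rewrite inE hy orbT.
Qed.

Hypothesis cfc_w : forall p, reduced M (factor p (p + N)) /\
  fully_commutative (val (factor p (p + N))).

Lemma factor_project p z (s t : 'I_n.+1) : adjacent s t ->
  size z = N -> val z = val (factor p (p + N)) ->
  [seq x <- factor p (p + N) | x \in [:: s; t]] = [seq x <- z | x \in [:: s; t]].
Proof.
move=> a sz ez; have [r fc] := cfc_w p.
have rz : reduced M z by apply: reduced_eq r ez _; rewrite size_factor sz addKn.
apply: commutation_project (fc _ _ (conj erefl r) (conj ez rz)) => _.
by move/(affineC_commE n_ge2); rewrite a.
Qed.

Lemma braid_swap3 (s t : 'I_n.+1) : adjacent s t -> 0 < s < n -> 0 < t < n ->
  val [:: s; t; s] = val [:: t; s; t].
Proof.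
move=> a hs ht.
have st : s != t by apply/eqP => h; move: a; rewrite h /adjacent; lia.
have m3 : M s t = 3.
  by rewrite /= /affineC_m (negbTE st) -/(adjacent s t) a /minn /maxn; do !case: ifP; lia.
have := @alternating_braid_val _ M (@affineC_m_le4 n) _ _ st.
by rewrite /alternating_braid (cox_mC M t s) m3.
Qed.

Lemma braid_swap4 (s t : 'I_n.+1) : adjacent s t -> t = 0 :> nat \/ t = n :> nat ->
  val [:: s; t; s; t] = val [:: t; s; t; s].
Proof.
move=> a ht.
have st : s != t by apply/eqP => h; move: a; rewrite h /adjacent; lia.
have m4 : M s t = 4.
  rewrite /= /affineC_m (negbTE st) -/(adjacent s t) a /minn /maxn.
  by have := ltn_ord s; have := ltn_ord t; do !case: ifP; lia.
have := @alternating_braid_val _ M (@affineC_m_le4 n) _ _ st.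
by rewrite /alternating_braid (cox_mC M t s) m4 /= => ->.
Qed.

(** The letters of B1 and B2 commute with s, so that the two occurrences of s can
    be moved next to t. *)
Lemma convex_chain3 (s t : 'I_n.+1) B1 B2 C :
  adjacent s t -> 0 < s < n -> 0 < t < n ->
  {in B1, forall x : 'I_n.+1, ~~ adjacent s x} ->
  {in B2, forall x : 'I_n.+1, ~~ adjacent s x} ->
  val (s :: B1 ++ t :: B2 ++ s :: C) = val (B1 ++ [:: t, s, t & B2 ++ C]).
Proof.
move=> a hs ht /gen_comm_word c1 /gen_comm_word c2; have := braid_swap3 a hs ht.
rewrite !(word_val_cat, word_val_cons) word_val_nil !mulg1 => e.
rewrite [LHS]mulgA c1 -mulgA; congr (_ * _).
rewrite (mulgA (val B2) (cox_gen M s)) -c2 -!mulgA.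
by have := congr1 (fun x => x * (val B2 * val C)) e; rewrite -!mulgA.
Qed.

(** Both occurrences of s are moved next to the first t, and then the second t
    next to the second s. *)
Lemma convex_chain4 (s t : 'I_n.+1) B1 B2 B3 C :
  adjacent s t -> t = 0 :> nat \/ t = n :> nat ->
  {in B1, forall x : 'I_n.+1, ~~ adjacent s x} ->
  {in B2, forall x : 'I_n.+1, ~~ adjacent s x} ->
  {in B2 ++ B3, forall x : 'I_n.+1, ~~ adjacent t x} ->
  val (s :: B1 ++ t :: B2 ++ s :: B3 ++ t :: C) =
  val (B1 ++ [:: t, s, t, s & (B2 ++ B3) ++ C]).
Proof.
move=> a ht /gen_comm_word c1 /gen_comm_word c2 /gen_comm_word.
have := braid_swap4 a ht.
rewrite !(word_val_cat, word_val_cons) word_val_nil !mulg1 => e c3.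
rewrite [LHS]mulgA c1 -mulgA; congr (_ * _).
rewrite (mulgA (val B2) (cox_gen M s)) -c2 -!mulgA.
rewrite (mulgA (val B2) (val B3) (_ * _)) 
  (mulgA (val B2 * val B3) (cox_gen M t)) -c3 -!mulgA.
by have := congr1 (fun x => x * (val B2 * (val B3 * val C))) e; rewrite -!mulgA.
Qed.

Lemma letter_per k : letter (k + N) = letter k.
Proof. by rewrite /letter modnDr. Qed.

(** In the fully commutative windows, words for the same element have
    the same projection on two adjacent letters s and t, whereas these two
    projections start with s and t respectively. *)
Lemma no_braid_rewriting (s t : 'I_n.+1) p C B D : adjacent s t ->
  size (B ++ t :: D) = N -> factor p (p + N) = s :: C ->
  val (B ++ t :: D) = val (s :: C) ->
  {in B, forall x, x \notin [:: s; t]} -> False.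
Proof.
move=> a sz ef; rewrite -ef => /(factor_project a sz); rewrite ef filter_cat /=.
rewrite !inE !eqxx orbT /= => e nB; move: e.
rewrite (_ : [seq _ <- B | _] = [::]); last first.
  by apply/eqP; rewrite -[_ == _]negbK -has_filter; apply/hasPn => x /nB; rewrite inE.
by case=> e; move: a; rewrite e /adjacent; lia.
Qed.

Lemma word_walk : cfc_walk n N (fun k => letter k).
Proof.
split=> [k|k|s p q [lpq ep eq nk] lq|s p q k [lpq ep eq nk] lq hs hk ak hWk
  |s t p q k r [lpq ep eq nk] lq a ht hs [lkr ek er nk'] hk lqr lr uniq nor].
- by have := ltn_ord (letter k).
- by rewrite letter_per.
- have [//|no] := pselect (exists2 k, p < k < q & adjacent s (letter k)).
  have [r _] := cfc_w p; exfalso.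
  have eqp : letter q = letter p by apply: ord_inj; rewrite ep eq.
  have := r (factor p.+1 q ++ factor q.+1 (p + N)).
  rewrite (@factor_cons p (p + N)) ?(@factor_split p.+1 q (p + N)) //; try lia.
  rewrite /= !size_cat /= !size_factor !(word_val_cat, word_val_cons) eqp.
  rewrite (mulgA (cox_gen _ _) (val (factor p.+1 q))).
  rewrite (@gen_comm_word _ (factor p.+1 q)); last first.
    move=> x /mem_factor[l hl ->]; apply/negP => al; apply: no.
    by exists l; [lia|rewrite -ep].
  by rewrite -mulgA cox_genK => /(_ erefl); lia.
- have [//|no] := pselect (exists2 k', p < k' < q & k' <> k /\ adjacent s (letter k')).
  exfalso.
  have nadj l : p < l < q -> l <> k -> ~~ adjacent s (letter l).
    by move=> hl nl; apply/negP => al; apply: no; exists l.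
  have eqp : letter q = letter p by apply: ord_inj; rewrite ep eq.
  have a : adjacent (letter p) (letter k) by rewrite ep.
  have ez : factor p (p + N) = letter p :: factor p.+1 k ++ letter k ::
      factor k.+1 q ++ letter p :: factor q.+1 (p + N).
    rewrite -{2}eqp (@factor_cons p (p + N)); last lia.
    rewrite (@factor_split p.+1 k); last lia.
    rewrite (@factor_split k.+1 q); last lia.
    reflexivity.
  have n1 : {in factor p.+1 k, forall x : 'I_n.+1, ~~ adjacent (letter p) x}.
    by move=> x /mem_factor[l hl ->]; rewrite ep; apply: nadj; lia.
  have n2 : {in factor k.+1 q, forall x : 'I_n.+1, ~~ adjacent (letter p) x}.
    by move=> x /mem_factor[l hl ->]; rewrite ep; apply: nadj; lia.
  have hs' : 0 < letter p < n by rewrite ep.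
  have vz := convex_chain3 (factor q.+1 (p + N)) a hs' hWk n1 n2.
  apply: (no_braid_rewriting a _ ez (esym vz)).
    by rewrite size_cat /= !size_cat !size_factor; lia.
  move=> x /mem_factor[l hl ->]; rewrite !inE negb_or -!val_eqE /= ep.
  rewrite (introF eqP (nk l _)) /=; last lia.
  by apply/eqP => e; have := nadj l; rewrite e ak; lia.
- have eqp : letter q = letter p by apply: ord_inj; rewrite ep eq.
  have erk : letter r = letter k by apply: ord_inj; rewrite ek er.
  have a' : adjacent (letter p) (letter k) by rewrite ep ek.
  have ez : factor p (p + N) = letter p :: factor p.+1 k ++ letter k ::
      factor k.+1 q ++ letter p :: factor q.+1 r ++ letter k :: factor r.+1 (p + N).
    rewrite -{2}eqp -{2}erk (@factor_cons p (p + N)); last lia.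
    rewrite (@factor_split p.+1 k); last lia.
    rewrite (@factor_split k.+1 q); last lia.
    rewrite (@factor_split q.+1 r); last lia.
    reflexivity.
  have nadj l : p < l < q -> l <> k -> ~~ adjacent (letter p) (letter l).
    by move=> hl nl; apply/negP => al; apply: nl; apply: uniq => //; rewrite -ep.
  have n1 : {in factor p.+1 k, forall x : 'I_n.+1, ~~ adjacent (letter p) x}.
    by move=> x /mem_factor[l hl ->]; apply: nadj; lia.
  have n2 : {in factor k.+1 q, forall x : 'I_n.+1, ~~ adjacent (letter p) x}.
    by move=> x /mem_factor[l hl ->]; apply: nadj; lia.
  have n3 : {in factor k.+1 q ++ factor q.+1 r,
      forall x : 'I_n.+1, ~~ adjacent (letter k) x}.
    move=> x; rewrite mem_cat => /orP[] /mem_factor[l hl ->]; rewrite ek.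
      have := nk l; have := ltn_ord (letter l); move: a; rewrite /adjacent; lia.
    have := nor l; have := ltn_ord (letter l); move: a; rewrite /adjacent; lia.
  have ht' : letter k = 0 :> nat \/ letter k = n :> nat by rewrite ek.
  have vz := convex_chain4 (factor r.+1 (p + N)) a' ht' n1 n2 n3.
  apply: (no_braid_rewriting a' _ ez (esym vz)).
    by rewrite size_cat /= !size_cat !size_factor; lia.
  move=> x /mem_factor[l hl ->]; rewrite !inE negb_or -!val_eqE /= ep.
  rewrite (introF eqP (nk l _)) /=; last lia.
  by apply/eqP => e; have := nadj l; rewrite e a'; lia.
Qed.
End PeriodicWord.

(** * Types (b) and (c) from the walk *)

Section ZigzagCounts.
Variable n : nat.
Hypothesis n_ge2 : 2 <= n.

Lemma count_zigzag_period (s : 'I_n.+1) :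
  count_mem s (zigzag_period n) = 1 + (0 < s < n).
Proof.
rewrite count_map (@eq_in_count _ _ (pred1 (s : nat))); last first.
  move=> i; rewrite mem_cat mem_rev !mem_iota => hi /=.
  by rewrite -val_eqE /= inordK //; lia.
rewrite count_cat count_rev !count_uniq_mem ?iota_uniq // !mem_iota.
by have := ltn_ord s; lia.
Qed.

Lemma count_zigzag_window (s : 'I_n.+1) a :
  count_mem s [seq zigzag n i | i <- iota a n.*2] = count_mem s (zigzag_period n).
Proof.
elim: a => [|a IH].
  congr count; apply: (@eq_from_nth _ ord0).
    by rewrite size_map size_iota (size_zigzag_period n_ge2).
  move=> i; rewrite size_map size_iota => hi.
  rewrite (nth_map 0) ?size_iota // nth_iota // add0n /zigzag (size_zigzag_period n_ge2).
  by rewrite modn_small.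
rewrite -IH; have -> : n.*2 = n.*2.-1 + 1 by lia.
rewrite [in LHS]iotaD map_cat count_cat addn1 /= addnC; congr (_ + _).
rewrite addn0; congr (nat_of_bool (_ == _)); apply: (zigzag_modE n_ge2).
rewrite (_ : a.+1 + n.*2.-1 = n.*2 + a) ?modnDl //; lia.
Qed.

Lemma count_zigzag_windows (s : 'I_n.+1) a j :
  count_mem s [seq zigzag n i | i <- iota a (j * n.*2)] = j * (1 + (0 < s < n)).
Proof.
elim: j a => [|j IH] a //.
by rewrite mulSn iotaD map_cat count_cat IH count_zigzag_window count_zigzag_period mulSn.
Qed.
End ZigzagCounts.

Section Characterization.
Variable n : nat.
Hypothesis n_ge2 : 2 <= n.
Variable w : seq 'I_n.+1.
Hypothesis w_nonempty : 0 < size w.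
Local Notation N := (size w).

Lemma map_letter : [seq letter w k | k <- iota 0 N] = w.
Proof. by have := factor_rot w_nonempty 0; rewrite mod0n rot0 /factor add0n subn0. Qed.

Lemma repeated_multi (s : 'I_n.+1) :
  1 < count_mem s w -> multi N (fun k => letter w k) s.
Proof.
move=> c.
have [p [q [lpq lq ep eq]]] : exists p q,
    [/\ p < q, q < N, nth ord0 w p = s & nth ord0 w q = s].
  have sw : s \in w by rewrite -has_pred1 has_count; lia.
  have [A [B ew]] : exists A B, w = A ++ s :: B by case/splitPr: sw => A B; exists A, B.
  have sA : count_mem s A + count_mem s B > 0.
    by move: c; rewrite ew count_cat /= eqxx; lia.
  have [sB|nB] := boolP (s \in B).
    have [B1 [B2 eB]] : exists B1 B2, B = B1 ++ s :: B2.
      by case/splitPr: sB => B1 B2; exists B1, B2.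
    exists (size A), (size A + (size B1).+1).
    rewrite ew eB !nth_cat !size_cat /= !size_cat ltnn subnn /=; split=> //; try lia.
    by rewrite ltnNge leq_addr addKn /= nth_cat ltnn subnn.
  have sA' : s \in A by move: sA; rewrite (count_memPn nB) addn0 -has_count has_pred1.
  have [A1 [A2 eA]] : exists B1 B2, A = B1 ++ s :: B2.
    by case/splitPr: sA' => B1 B2; exists B1, B2.
  exists (size A1), (size A); split.
  - by rewrite eA size_cat /=; lia.
  - by rewrite ew size_cat /=; lia.
  - by rewrite ew eA -catA nth_cat ltnn subnn.
  - by rewrite ew nth_cat ltnn subnn.
exists p, q; rewrite /letter !modn_small ?ep ?eq //; last lia.
by split=> //; lia.
Qed.

Hypothesis walkW : cfc_walk n N (fun k => letter w k).

(** The walk is the zigzag from some phase on; as it has period N, so has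
    the zigzag, hence N is a multiple of 2n and the counts are those of a number
    of full periods. *)
Lemma turning_zigzag : turning N (fun k => letter w k) 1 ->
  zigzag_subword w /\
  (exists2 c, 2 <= c &
        [/\ forall s : 'I_n.+1, 0 < s < n -> count_mem s w = c,
            2 * count_mem ord0 w = c
          & 2 * count_mem ord_max w = c]).
Proof.
move=> t1; have [a ha] := walk_zigzag n_ge2 walkW t1.
have ew : w = [seq zigzag n i | i <- iota a N].
  rewrite -{1}map_letter -{1}[a]addn0 iotaDl -map_comp; apply: eq_map => k /=.
  by apply: ord_inj; rewrite ha zigzagE.
have zper k : zigzag_val n (a + N + k) = zigzag_val n (a + k).
  by rewrite -addnA -!ha addnC letter_per.
have /dvdnP[j ej] : n.*2 %| N.
  have := zigzag_val_inj2 n_ge2 (j := a + N) (k := a).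
  have := zper 0; rewrite !addn0 => -> /(_ erefl).
  have := zper 1; rewrite !addn1 => -> /(_ erefl) /eqP.
  by rewrite -[X in _ == X %[mod _]]addn0 eqn_modDl mod0n.
split; first by exists a.
exists (j * 2); first by case: j ej; lia.
split=> [s hs||]; rewrite ew ej (count_zigzag_windows n_ge2) ?hs //=; lia.
Qed.

(** Two equal consecutive letters in the projection would be two
    positions with the same letter and neither letter in between. *)
Lemma sorted_project_letters (i j : 'I_n.+1) K :
  (forall p q, p < q -> letter w p = letter w q -> letter w p \in [:: i; j] ->
    exists2 k, p < k < q & letter w k \in [:: i; j] /\ letter w k != letter w p) ->
  sorted (fun x y => x != y)
    [seq x <- [seq letter w k | k <- iota 0 K] | x \in [:: i; j]].
Proof.
move=> h.
set L := fun K => [seq x <- [seq letter w k | k <- iota 0 K] | x \in [:: i; j]].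
have LS k : L k.+1 = if letter w k \in [:: i; j] then rcons (L k) (letter w k) else L k.
  rewrite /L -[k.+1 in LHS]addn1 iotaD map_cat filter_cat /= add0n.
  case: ifP; by rewrite ?cats1 ?cats0.
have Llast k : L k = [::] \/ exists2 p, p < k & [/\ last i (L k) = letter w p,
    letter w p \in [:: i; j] & forall l, p < l < k -> letter w l \notin [:: i; j]].
  elim: k => [|k IH]; first by left.
  rewrite LS; case: ifP => hk.
    by right; exists k => //; split=> //; [rewrite last_rcons|lia].
  case: IH => [->|[p lp [e hp np]]]; [by left|right]; exists p; [lia|split=> // l hl].
  by have [->|ne] := eqVneq l k; [rewrite hk|apply: np; lia].
rewrite -/(L K); elim: K => // K IH; rewrite LS; case: ifP => // hK.
have [->//|[p lp [e hp np]]] := Llast K.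
move: IH e; case: (L K) => [|x P] //= pP e; rewrite rcons_path pP /= e.
apply/eqP => ep; have [k hk [kij _]] := h p K lp ep hp.
by have := np k hk; rewrite kij.
Qed.

(** Equality of the counts comes from the projection of w w, which alternates
    as well: the projection X of w then has distinct end letters. *)
Lemma straight_alternating (s : 'I_n.+1) : 1 < count_mem s w ->
  ~ turning N (fun k => letter w k) 1 ->
  alternating w /\ (exists2 c, 2 <= c & forall s : 'I_n.+1, count_mem s w = c).
Proof.
move=> c nt; have ms := repeated_multi c.
have srt (i j : 'I_n.+1) K : i.+1 = j :> nat -> sorted (fun x y => x != y)
    [seq x <- [seq letter w k | k <- iota 0 K] | x \in [:: i; j]].
  move=> eij; apply: sorted_project_letters => p q lpq e.
  have btw (x y : 'I_n.+1) : adjacent x y -> letter w p = x ->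
     exists2 k, p < k < q & letter w k = y.
    move=> a ex.
    have [|||||k hk ek] :=
      straight_between n_ge2 walkW nt (s := x) (t := y) (p := p) (q := q) _ _ _ a lpq.
    - by exists s => //; rewrite -ltnS ltn_ord.
    - by rewrite -ltnS ltn_ord.
    - by rewrite -ltnS ltn_ord.
    - by rewrite ex.
    - by rewrite -e ex.
    by exists k => //; apply: ord_inj.
  have nij : (i == j) = false by rewrite -val_eqE /=; lia.
  rewrite !inE => /orP[] /eqP ex; rewrite ex.
    have [|k hk ek] := btw i j _ ex; first by rewrite /adjacent eij eqxx.
    by exists k => //; rewrite ek !inE eqxx orbT eq_sym nij.
  have [|k hk ek] := btw j i _ ex; first by rewrite /adjacent eij eqxx orbT.
  by exists k => //; rewrite ek !inE eqxx nij.
split; first by move=> i j e; rewrite -map_letter; apply: srt.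
have ceq (i j : 'I_n.+1) : i.+1 = j :> nat -> count_mem i w = count_mem j w.
  move=> e; have ne : i != j by rewrite -val_eqE /=; lia.
  have := srt i j (N + N) e; rewrite iotaD map_cat map_letter add0n.
  rewrite -[X in iota X]addn0 iotaDl -map_comp.
  rewrite (eq_map (g := letter w)); last by move=> k /=; rewrite addnC letter_per.
  rewrite map_letter filter_cat; set X := filter _ _ => sX.
  have cX x : x \in [:: i; j] -> count_mem x X = count_mem x w.
    by move=> hx; rewrite count_filter; apply: eq_count => y /=; case: eqP => // ->.
  rewrite -(cX i) ?inE ?eqxx // -(cX j) ?inE ?eqxx ?orbT //.
  have aX : all [in [:: i; j]] X by apply: filter_all.
  case: X sX aX {cX} => [|x P] //= sX /andP[xij aP].
  move: sX; rewrite cat_path /= => /and3P[pP lP _].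
  move: xij; rewrite !inE => /orP[] /eqP ex; subst x.
    have := count_alternating_path ne aP pP; rewrite (negbTE lP) /=; lia.
  rewrite eq_sym in ne; have aP' : all [in [:: j; i]] P.
    by apply: sub_all aP => z; rewrite !inE orbC.
  have := count_alternating_path ne aP' pP; rewrite (negbTE lP) /=; lia.
have call (s' : 'I_n.+1) : count_mem s' w = count_mem ord0 w.
  case: s' => k; elim: k => [|k IH] lk.
    by rewrite (_ : Ordinal lk = ord0) //; apply: ord_inj.
  by rewrite -(IH (ltnW lk)); apply/esym/ceq.
by exists (count_mem ord0 w) => //; rewrite -(call s).
Qed.
End Characterization.

Lemma cfc_condition_necessary n (w : seq 'I_n.+1) : 2 <= n ->
  reduced (affineC_matrix n) w ->
  cyclically_fully_commutative (word_val (affineC_matrix n) w) -> cfc_condition w.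
Proof.
move=> n_ge2 rw cfc.
have [small|] := pselect (forall s : 'I_n.+1, count_mem s w <= 1); first exact: Or31.
move=> /existsNP[s /negP]; rewrite -ltnNge => c.
have w0 : 0 < size w by case: (w) c.
have walkW : cfc_walk n (size w) (fun k => letter w k).
  apply: word_walk => // p; rewrite factor_rot //.
  exact: cfc (conj erefl rw) _.
have [t1|nt1] := pselect (turning (size w) (fun k => letter w k) 1).
  by apply: Or33; apply: turning_zigzag.
by apply: Or32; apply: straight_alternating c nt1.
Qed.

Theorem theorem3p1 (n : nat) (hn : (2 <= n)%N) (w : affineC n) :
  (cyclically_fully_commutative w <->
     exists ww : seq 'I_n.+1, reduced_expr ww w /\ cfc_condition ww) /\
  (cyclically_fully_commutative w <->
     forall ww : seq 'I_n.+1, reduced_expr ww w -> cfc_condition ww).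
Proof.
have cfc_all : cyclically_fully_commutative w ->
    forall ww : seq 'I_n.+1, reduced_expr ww w -> cfc_condition ww.
  by move=> cfc ww [e r]; apply: cfc_condition_necessary; rewrite ?e.
have ex_cfc : (exists ww : seq 'I_n.+1, reduced_expr ww w /\ cfc_condition ww) ->
    cyclically_fully_commutative w.
  by case=> ww [[<- _] c]; apply: cfc_condition_sufficient.
have all_ex : (forall ww : seq 'I_n.+1, reduced_expr ww w -> cfc_condition ww) ->
    exists ww : seq 'I_n.+1, reduced_expr ww w /\ cfc_condition ww.
  by move=> h; have [ww r] := reduced_exists w; exists ww; split; last exact: h.
by split; split=> [/cfc_all|] // h; auto.
Qed.
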